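(* Let $(R,\mathfrak{m},k)$ be a commutative noetherian local ring with $k$ infinite and $\dim R=1$. Set $n=\max\{c,g\}+1$, where $$c=\inf\{i\mid \text{there exists a parameter } x \text{ of } R \text{ such that } \mathfrak{m}^{i+1}=(x)\mathfrak{m}^i\},\qquad g=\inf\{i\mid \mathfrak{m}^i\cap\Gamma_{\mathfrak{m}}(R)=0\}.$$ Then $R$ is Gorenstein if and only if some parameter ideal of $R$ contained in $\mathfrak{m}^n$ is irreducible.
   Context: The infima are over integers $i\ge 0$, with $\mathfrak{m}^0=R$; both are finite under the hypotheses. $\Gamma_{\mathfrak{m}}(R)=\{r\in R\mid \mathfrak{m}^i r=0\text{ for some }i\}$. Since $\dim R=1$, a parameter of $R$ is an element $x\in\mathfrak{m}$ with $\mathfrak{m}^i\subseteq (x)$ for some $i$, and a parameter ideal is an ideal generated by a parameter. An ideal $\mathfrak{q}$ of $R$ is reducible if $\mathfrak{q}=\mathfrak{b}\cap\mathfrak{c}$ for two ideals $\mathfrak{b},\mathfrak{c}$ of $R$ strictly containing $\mathfrak{q}$; otherwise it is irreducible. *)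

(* Defs.v *)
From HB Require Import structures.
From mathcomp Require Import all_boot all_order all_algebra.
From mathcomp Require Import boolp classical_sets functions cardinality.

Set Implicit Arguments.
Unset Strict Implicit.
Unset Printing Implicit Defensive.

Import GRing.Theory.
Local Open Scope classical_set_scope.
Local Open Scope ring_scope.

(* xget makes this 0 on the empty set, where the infimum would be +oo. *)
Definition nat_inf (S : set nat) : nat :=
  xget 0%N [set i | S i /\ forall j, S j -> (i <= j)%N].

Section Ideals.
Variable R : comNzRingType.
Implicit Types I J P : set R.

(* mathcomp's idealr_closed is boolean and excludes the unit ideal, which is
   needed here as the zeroth power of an ideal. *)
Definition is_ideal I : Prop :=
  [/\ I 0, forall x y, I x -> I y -> I (x + y)
         & forall a x, I x -> I (a * x)].

Definition ideal_gen (A : set R) : set R := smallest is_ideal A.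

Definition ideal_mul I J : set R := ideal_gen [set x * y | x in I & y in J].

Definition ideal_exp I n : set R := iter n (ideal_mul I) [set: R].

Definition principal (x : R) : set R := ideal_gen [set x].

Definition is_prime_ideal P : Prop :=
  [/\ is_ideal P, ~ P 1 & forall x y, P (x * y) -> P x \/ P y].

Definition is_maximal_ideal I : Prop :=
  [/\ is_ideal I, ~ I 1
    & forall J, is_ideal J -> ~ J 1 -> I `<=` J -> J = I].

Definition is_local (m : set R) : Prop :=
  is_maximal_ideal m /\ forall m', is_maximal_ideal m' -> m' = m.

Definition prime_chain (n : nat) : Prop :=
  exists P : nat -> set R,
    (forall i, (i <= n)%N -> is_prime_ideal (P i)) /\
    (forall i, (i < n)%N -> P i `<` P i.+1).

Definition reducible I : Prop :=
  exists b c : set R,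
    [/\ is_ideal b, is_ideal c, I `<` b, I `<` c & I = b `&` c].

Definition irreducible_ideal I : Prop := is_ideal I /\ ~ reducible I.

Definition is_parameter (m : set R) (x : R) : Prop :=
  m x /\ exists i, ideal_exp m i `<=` principal x.

Definition is_parameter_ideal (m q : set R) : Prop :=
  exists2 x, is_parameter m x & q = principal x.

Definition Gamma (m : set R) : set R :=
  [set r | exists i, forall a, ideal_exp m i a -> a * r = 0].

Definition c_inv (m : set R) : nat :=
  nat_inf [set i | exists2 x, is_parameter m x
    & ideal_exp m i.+1 = ideal_mul (principal x) (ideal_exp m i)].

Definition g_inv (m : set R) : nat :=
  nat_inf [set i | ideal_exp m i `&` Gamma m = [set 0]].

End Ideals.

Definition is_noetherian (R : comNzRingType) : Prop :=
  forall I : set R, is_ideal I -> exists s : seq R, I = ideal_gen [set` s].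

Definition krull_dim_eq (R : comNzRingType) (n : nat) : Prop :=
  prime_chain R n /\ forall l, prime_chain R l -> (l <= n)%N.

Definition injective_module (R : comNzRingType) (E : lmodType R) : Prop :=
  forall (A B : lmodType R) (f : {linear A -> B}) (u : {linear A -> E}),
    injective f -> exists h : {linear B -> E}, forall a, h (f a) = u a.

(* An injective resolution 0 -> M -> I 0 -> I 1 -> ... -> I n -> 0, encoded as
   an infinite sequence whose terms of index > n are zero. *)
Definition has_finite_injdim (R : comNzRingType) (M : lmodType R) : Prop :=
  exists (n : nat) (I : nat -> lmodType R)
         (e : {linear M -> I 0%N}) (d : forall i, {linear I i -> I i.+1}),
    [/\ (forall i, injective_module (I i)),
        (forall i, (n < i)%N -> forall x : I i, x = 0),
        injective e,
        range e = d 0%N @^-1` [set 0]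
      & forall i, range (d i) = d i.+1 @^-1` [set 0]].

(* The definition for local rings: R has finite injective dimension over
   itself. *)
Definition gorenstein (R : comNzRingType) : Prop := has_finite_injdim R^o.

(* Main.v *)
From HB Require Import structures.
Require Import Defs.
From mathcomp Require Import all_boot all_order all_algebra.
From mathcomp Require Import boolp classical_sets functions cardinality.
From mathcomp Require Import ring.

Set Implicit Arguments.
Unset Strict Implicit.
Unset Printing Implicit Defensive.

Import GRing.Theory.
Local Open Scope classical_set_scope.
Local Open Scope ring_scope.

(** A one-dimensional noetherian local ring R is Gorenstein as soon as one deep
    enough parameter ideal is irreducible, because such an ideal forces depth 1,
    and because the property then passes from R/(x) to R. Being irreducible means
    for (x) that the socle of R/(x) is simple, that is, generated by one element s
    modulo (x).

    Suppose that R has finite injective dimension. Fix an injective resolution and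
    let Ext^i(R/I, R) be its cohomology at the elements killed by I. These groups
    are finitely generated ([ext_fg]), and the exact sequences attached to
    0 -> R/(I : a) -> R/I -> R/(I + (a)) -> 0 ([ext_lift], [ext0_devissage]) allow
    a descending induction on i: if m is the annihilator of an element of R/I0 and
    Ext^i(R/I0, R) vanishes for i >= j, then so does Ext^i(R/I, R) for all I
    containing I0 ([ext0_vanish]). With I0 = 0 and j = 1, an R of depth 0 would
    be self-injective, and then no prime other than m could annihilate a nonzero
    element, which is absurd in dimension 1 ([depth_pos]). So parameters are
    regular, and I0 = (x) with j = 2 shows that multiplication by s maps
    Ext^1(R/(x), R) = R/(x) onto Ext^1(R/m, R), which contains the socle of
    R/(x); thus the socle is cyclic ([socle_cyclic]). All parameter ideals are
    therefore irreducible, and powers of a parameter lie in m^n.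

    Conversely let (x) be irreducible with x in m^(g+1), where m^g meets
    Gamma = Gamma_m(R) trivially. If Gamma were not zero, a socle element of R
    would generate the socle of R/(x); comparing with an element of m^g outside
    (x) gives a contradiction ([socle_zero]). So x is regular, and every R/(x^k)
    has simple socle ([socle_gen_exp]). A length count then gives
    (J : (J : I)) = I for J = (x^k) and all I containing J ([double_colon]), hence
    R/(x^k) is self-injective ([self_injective]). Passing to the limit, R[1/x]/R
    is injective ([quotient_extends]), and by Nakayama's lemma so is R[1/x]
    ([localization_extends]): 0 -> R -> R[1/x] -> R[1/x]/R -> 0 is an injective
    resolution. *)

(** * Ideals, their powers and colons *)

Section IdealCalculus.
Variable R : comNzRingType.
Implicit Types (I J P m : set R) (a b x y r : R).

(** [adjoin I a] is the ideal I + (a). *)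
Definition adjoin I a : set R := [set z | exists r, I (z - r * a)].
(** [colon I a] is the ideal (I : a). *)
Definition colon I a : set R := [set r | I (r * a)].
(** [colonI J I] is the ideal (J : I). *)
Definition colonI J I : set R := [set r | forall a, I a -> J (r * a)].

Lemma ideal0 I : is_ideal I -> I 0. Proof. by case. Qed.
Lemma idealD I x y : is_ideal I -> I x -> I y -> I (x + y).
Proof. by case=> _ + _; apply. Qed.
Lemma idealMl I a x : is_ideal I -> I x -> I (a * x).
Proof. by case=> _ _; apply. Qed.
Lemma idealMr I a x : is_ideal I -> I x -> I (x * a).
Proof. by rewrite mulrC; exact: idealMl. Qed.
Lemma idealN I x : is_ideal I -> I x -> I (- x).
Proof. by rewrite -mulN1r; exact: idealMl. Qed.
Lemma idealB I x y : is_ideal I -> I x -> I y -> I (x - y).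
Proof. by move=> iI Ix Iy; apply: idealD => //; exact: idealN. Qed.

Lemma ideal_gen_ideal (A : set R) : is_ideal (ideal_gen A).
Proof.
split=> [I [iI _]|x y Ax Ay I HI|a x Ax I HI]; first exact: ideal0.
- by case: (HI) => iI _; apply: idealD => //; [exact: Ax|exact: Ay].
- by case: (HI) => iI _; apply: idealMl => //; exact: Ax.
Qed.

Lemma ideal_gen_min (A I : set R) : is_ideal I -> A `<=` I -> ideal_gen A `<=` I.
Proof. by move=> iI AI; apply: smallest_sub. Qed.

Lemma ideal_gen_sub (A : set R) : A `<=` ideal_gen A.
Proof. exact: sub_gen_smallest. Qed.

Lemma idealT : @is_ideal R setT. Proof. by []. Qed.

Lemma ideal_set0 : @is_ideal R [set 0].
Proof. by split=> [|x y /= -> ->|a x /= ->] //; rewrite ?addr0 ?mulr0. Qed.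

Lemma idealI I J : is_ideal I -> is_ideal J -> is_ideal (I `&` J).
Proof.
move=> iI iJ; split=> [|x y [Ix Jx] [Iy Jy]|a x [Ix Jx]].
- by split; exact: ideal0.
- by split; exact: idealD.
- by split; exact: idealMl.
Qed.

Lemma principalE x : principal x = [set z | exists r, z = r * x].
Proof.
apply/seteqP; split=> [|z [r ->]].
  apply: ideal_gen_min => [|_ ->]; last by exists 1; rewrite mul1r.
  split=> [|_ _ [r ->] [s ->]|a _ [r ->]].
  - by exists 0; rewrite mul0r.
  - by exists (r + s); rewrite mulrDl.
  - by exists (a * r); rewrite mulrA.
by apply: (idealMl _ (ideal_gen_ideal _)); exact: ideal_gen_sub.
Qed.

Lemma principal_ideal x : is_ideal (principal x).
Proof. exact: ideal_gen_ideal. Qed.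

Lemma principal_mem x : principal x x.
Proof. exact: ideal_gen_sub. Qed.

Lemma principal_sub x I : is_ideal I -> I x -> principal x `<=` I.
Proof. by move=> iI Ix; apply: ideal_gen_min => // _ ->. Qed.

Lemma adjoin_ideal I a : is_ideal I -> is_ideal (adjoin I a).
Proof.
move=> iI; split=> [|x y [r Ir] [s Is]|b x [r Ir]].
- by exists 0; rewrite mul0r subr0; exact: ideal0.
- exists (r + s); have -> : x + y - (r + s) * a = (x - r * a) + (y - s * a).
    by ring.
  exact: idealD.
- exists (b * r); have -> : b * x - b * r * a = b * (x - r * a) by ring.
  exact: idealMl.
Qed.

Lemma sub_adjoin I a : I `<=` adjoin I a.
Proof. by move=> x Ix; exists 0; rewrite mul0r subr0. Qed.

Lemma adjoin_mem I a : is_ideal I -> adjoin I a a.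
Proof. by move=> iI; exists 1; rewrite mul1r subrr; exact: ideal0. Qed.

Lemma adjoin_min I J a : is_ideal J -> I `<=` J -> J a -> adjoin I a `<=` J.
Proof.
move=> iJ IJ Ja z [r /IJ Jz]; rewrite -(subrK (r * a) z).
by apply: idealD => //; exact: idealMl.
Qed.

Lemma adjid I a : is_ideal I -> I a -> adjoin I a = I.
Proof.
by move=> iI Ia; apply/seteqP; split; [exact: adjoin_min|exact: sub_adjoin].
Qed.

Lemma proper_adjoin I a : is_ideal I -> ~ I a -> I `<` adjoin I a.
Proof.
move=> iI Ia; split; first exact: sub_adjoin.
by move=> aI; apply/Ia/aI/adjoin_mem.
Qed.

Lemma colon_ideal I a : is_ideal I -> is_ideal (colon I a).
Proof.
move=> iI; split=> [|x y Ix Iy|b x Ix]; rewrite /colon /=.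
- by rewrite mul0r; exact: ideal0.
- by rewrite mulrDl; exact: idealD.
- by rewrite -mulrA; exact: idealMl.
Qed.

Lemma sub_colon I a : is_ideal I -> I `<=` colon I a.
Proof. by move=> iI x Ix; exact: idealMr. Qed.

Lemma colonI_ideal J I : is_ideal J -> is_ideal (colonI J I).
Proof.
move=> iJ; split=> [a Ia|x y Jx Jy a Ia|b x Jx a Ia].
- by rewrite mul0r; exact: ideal0.
- by rewrite mulrDl; apply: idealD => //; [exact: Jx|exact: Jy].
- by rewrite -mulrA; apply: idealMl => //; exact: Jx.
Qed.

Lemma colonIS J I I' : I `<=` I' -> colonI J I' `<=` colonI J I.
Proof. by move=> II' r Jr a /II'; exact: Jr. Qed.

Lemma sub_colonIK J I : I `<=` colonI J (colonI J I).
Proof. by move=> a Ia r Jr; rewrite mulrC; exact: Jr. Qed.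

Lemma colonI_adjoin J I b : is_ideal J -> is_ideal I ->
  colonI J (adjoin I b) = colonI J I `&` colon J b.
Proof.
move=> iJ iI; apply/seteqP; split=> [r Jr|r [JrI Jrb] z [t It]].
  by split; [exact: (colonIS (@sub_adjoin I b))|exact/Jr/adjoin_mem].
have -> : r * z = r * (z - t * b) + t * (r * b) by ring.
by apply: idealD => //; [exact: JrI|exact: idealMl].
Qed.

Lemma ideal_mul_ideal I J : is_ideal (ideal_mul I J).
Proof. exact: ideal_gen_ideal. Qed.

Lemma ideal_mul_mem I J x y : I x -> J y -> ideal_mul I J (x * y).
Proof. by move=> Ix Jy; apply: ideal_gen_sub; exists x => //; exists y. Qed.

Lemma ideal_mul_min I J K : is_ideal K ->
  (forall x y, I x -> J y -> K (x * y)) -> ideal_mul I J `<=` K.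
Proof.
by move=> iK IJK; apply: ideal_gen_min => // _ [x Ix [y Jy <-]]; exact: IJK.
Qed.

Lemma ideal_exp_ideal m n : is_ideal (ideal_exp m n).
Proof. by case: n => [|n]; [exact: idealT|exact: ideal_mul_ideal]. Qed.

Lemma ideal_expS_sub m n : ideal_exp m n.+1 `<=` ideal_exp m n.
Proof.
apply: ideal_mul_min; first exact: ideal_exp_ideal.
by move=> x y _ my; apply: idealMl => //; exact: ideal_exp_ideal.
Qed.

Lemma ideal_exp_le m i j : (i <= j)%N -> ideal_exp m j `<=` ideal_exp m i.
Proof.
move=> /subnK <-; elim: (j - i)%N => [|d IH]; first exact: subset_refl.
by move=> x /ideal_expS_sub /IH.
Qed.

Lemma ideal_expX m i x : m x -> ideal_exp m i (x ^+ i).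
Proof.
by move=> mx; elim: i => // i IH; rewrite exprS; exact: ideal_mul_mem.
Qed.

Lemma ideal_exp1 m : is_ideal m -> ideal_exp m 1 = m.
Proof.
move=> im; apply/seteqP; split=> [|x mx].
  by apply: ideal_mul_min => // x y mx _; exact: idealMr.
by rewrite -[x]expr1; exact: (@ideal_expX _ 1).
Qed.

Lemma ideal_expD_sub m i j :
  ideal_exp m (i + j) `<=` ideal_mul (ideal_exp m i) (ideal_exp m j).
Proof.
elim: i => [z mz|i IH]; first by rewrite -[z]mul1r; exact: ideal_mul_mem.
apply: ideal_mul_min => [|a b ma mb]; first exact: ideal_mul_ideal.
rewrite mulrC; suff /(_ _ (IH _ mb)) : ideal_mul (ideal_exp m i) (ideal_exp m j)
  `<=` colon (ideal_mul (ideal_exp m i.+1) (ideal_exp m j)) a by [].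
apply: ideal_mul_min => [|c d mc md].
  by apply: colon_ideal; exact: ideal_mul_ideal.
rewrite /colon /= (_ : c * d * a = (a * c) * d); last by ring.
by apply: ideal_mul_mem => //; exact: (ideal_mul_mem ma mc).
Qed.

Lemma principal_expX m i x j : ideal_exp m i `<=` principal x ->
  ideal_exp m (j * i) `<=` principal (x ^+ j).
Proof.
move=> mi; elim: j => [z _|j IH].
  by rewrite expr0 principalE; exists z; rewrite mulr1.
rewrite mulSn => z /ideal_expD_sub; apply: ideal_mul_min.
  exact: principal_ideal.
move=> {}z t /mi + /IH; rewrite !principalE => -[r ->] [s ->].
by exists (r * s); rewrite exprS; ring.
Qed.

(** Some power of m sends t into I; multiply t by elements of m as long as the
    product stays outside I. *)
Lemma socle_element m I t i : is_ideal I -> ~ I t ->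
  (forall a, ideal_exp m i a -> I (a * t)) ->
  exists r, ~ I (r * t) /\ forall a, m a -> I (a * (r * t)).
Proof.
move=> iI; elim: i t => [|i IH] t It mt.
  by case: It; rewrite -[t]mul1r; exact: mt.
have [mtI|] := pselect (forall a, m a -> I (a * t)).
  by exists 1; rewrite mul1r.
move=> /existsNP[b /not_implyP[mb Ibt]].
have [|r [Hr mr]] := IH _ Ibt.
  by move=> a ma; rewrite mulrA (mulrC a); apply: mt; exact: ideal_mul_mem.
by exists (r * b); rewrite -mulrA.
Qed.

Hypothesis noeth : is_noetherian R.

(** By Zorn's lemma: the union of a nonempty chain of ideals has finitely many
    generators, so that it belongs to the chain. *)
Lemma noeth_max (F : set (set R)) : F `<=` @is_ideal R -> F !=set0 ->
  exists I, F I /\ forall J, F J -> I `<=` J -> J = I.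
Proof.
move=> FS [I0 FI0]; have Fi I : F I -> is_ideal I by exact: FS.
(* The empty set is added to F so that the empty chain has its union in it. *)
have [|A [PA maxA]] := @Zorn_bigcup _ (F `|` [set set0]); last first.
  case: PA => [FA|A0].
    exists A; split=> // J FJ AJ; apply: contrapT => JA.
    apply: (maxA J); last by left.
    by split=> // JA'; apply: JA; exact/seteqP.
  exfalso; apply: (maxA I0); last by left.
  rewrite A0; split; first exact: sub0set.
  by move=> I00; have /I00 := ideal0 (Fi _ FI0).
move=> G GP Gtot.
have [[I1 GI1 FI1]|noF] := pselect (exists2 I, G I & F I); last first.
  right; apply/seteqP; split=> // x [I GI Ix].
  case: (GP _ GI) => [FI|I00]; last by rewrite I00 in Ix.
  by case: noF; exists I.
left; set U := \bigcup_(X in G) X.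
have HU x y : U x -> U y -> exists I, [/\ G I, F I, I x & I y].
  move=> [I GI Ix] [J GJ Jy].
  have FI : F I by case: (GP _ GI) => // I00; rewrite I00 in Ix.
  have FJ : F J by case: (GP _ GJ) => // J00; rewrite J00 in Jy.
  by case: (Gtot I J GI GJ) => IJ; [exists J|exists I]; split=> //; exact: IJ.
have iU : is_ideal U.
  split=> [|x y Ux Uy|a x Ux].
  - by exists I1 => //; apply: ideal0; exact: Fi.
  - have [I [GI FI Ix Iy]] := HU _ _ Ux Uy.
    by exists I => //; apply: idealD => //; exact: Fi.
  - have [I [GI FI Ix _]] := HU _ _ Ux Ux.
    by exists I => //; apply: idealMl => //; exact: Fi.
have [s Us] := noeth iU.
suff [I [GI FI sI]] : exists I, [/\ G I, F I & [set` s] `<=` I].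
  suff -> : U = I by [].
  apply/seteqP; split; last by move=> x Ix; exists I.
  by rewrite Us; apply: ideal_gen_min => //; exact: Fi.
have : forall x, x \in s -> U x by move=> x xs; rewrite Us; exact: ideal_gen_sub.
elim: s {Us} => [_|a s IH sU]; first by exists I1.
have [x xs|I [GI FI sI]] := IH; first by apply: sU; rewrite inE xs orbT.
have [J GJ Ja] : U a by apply: sU; rewrite mem_head.
have FJ : F J by case: (GP _ GJ) => // J00; rewrite J00 in Ja.
case: (Gtot I J GI GJ) => IJ; [exists J|exists I]; split=> // x /=;
  rewrite inE => /orP[/eqP-> //|xs].
- by apply: IJ; exact: sI.
- exact: IJ.
- exact: sI.
Qed.

Lemma noeth_ind (P : set R -> Prop) :
  (forall I, is_ideal I ->
    (forall J, is_ideal J -> I `<` J -> P J) -> P I) ->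
  forall I, is_ideal I -> P I.
Proof.
move=> H I iI; apply: contrapT => PI.
have [|| M [[iM PM] Mmax]] := @noeth_max [set I | is_ideal I /\ ~ P I].
- by move=> ? [].
- by exists I.
apply: PM; apply: H => // J iJ MJ; apply: contrapT => PJ.
by case: (MJ) => MJ1; case; rewrite (Mmax J).
Qed.

(** Two forms of induction along a finite generating family of I, added one
    element at a time: from I down to a smaller ideal, and from 0 up to I. *)
Lemma ideal_ind_down I (P : set R -> Prop) : P I ->
  (forall J a, is_ideal J -> J `<=` I -> I a -> P (adjoin J a) -> P J) ->
  forall J, is_ideal J -> is_ideal I -> J `<=` I -> P J.
Proof.
move=> PI step J iJ iI; move: J iJ; apply: noeth_ind => J iJ IH JI.
have [IJ|] := pselect (I `<=` J); first by have -> : J = I by exact/seteqP.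
move=> /existsNP[a /not_implyP[Ia Ja]]; apply: (step J a) => //.
by apply: IH; [exact: adjoin_ideal|exact: proper_adjoin|exact: adjoin_min].
Qed.

Lemma ideal_ind_up I (P : set R -> Prop) : is_ideal I -> P [set 0] ->
  (forall J a, is_ideal J -> J `<=` I -> I a -> P J -> P (adjoin J a)) -> P I.
Proof.
move=> iI P0 step; move: P0.
apply: (@ideal_ind_down I (fun J => P J -> P I)) => //.
- by move=> J a iJ JI Ia PJ /(step _ a iJ JI Ia).
- exact: ideal_set0.
- by move=> _ ->; exact: ideal0.
Qed.

(** Among the proper ideals (I : a) the maximal ones are prime. Keeping only
    those that avoid a multiplicative set gives associated primes, and associated
    primes that lie inside a given prime and avoid the powers of an element. *)
Lemma assoc_prime I (S : set R) : is_ideal I -> S 1 ->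
  (forall s t, S s -> S t -> S (s * t)) -> I `&` S = set0 ->
  exists c, is_prime_ideal (colon I c) /\ colon I c `&` S = set0.
Proof.
move=> iI S1 SM IS.
have [|| M [[c [-> cS]] Mmax]] :=
    @noeth_max [set J | exists c, J = colon I c /\ J `&` S = set0].
- by move=> _ [c [-> _]]; exact: colon_ideal.
- by exists I, 1; split=> //; apply/seteqP; split=> x; rewrite /colon /= mulr1.
exists c; split=> //.
have disj t x : colon I t `&` S = set0 -> colon I t x -> ~ S x.
  by move=> E Ix Sx; have : (colon I t `&` S) x by []; rewrite E.
split; first exact: colon_ideal.
  by move=> /(disj _ _ cS).
move=> r s Irs; have [Ir|Ir] := pselect (colon I c r); [by left|right].
have [E|] := pselect (colon I (c * r) `&` S = set0).
  have <- : colon I (c * r) = colon I c.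
    apply: Mmax; first by exists (c * r).
    by move=> x Ix; rewrite /colon /= mulrA; exact: idealMr.
  by move: Irs; rewrite /colon /=; congr I; ring.
move=> /eqP/set0P[t [Itcr St]]; exfalso; apply: Ir.
suff <- : colon I (c * t) = colon I c.
  by move: Itcr; rewrite /colon /=; congr I; ring.
apply: Mmax; last first.
  by move=> x Ix; rewrite /colon /= mulrA; exact: idealMr.
exists (c * t); split=> //; apply/seteqP; split=> // x [Ix Sx].
apply: (disj c (x * t)) => //; last exact: SM.
by move: Ix; rewrite /colon /=; congr I; ring.
Qed.

Lemma assoc_prime1 I : is_ideal I -> ~ I 1 ->
  exists c, is_prime_ideal (colon I c).
Proof.
move=> iI I1; have [|||c []] := @assoc_prime I [set 1] iI.
- by [].
- by move=> _ _ -> ->; rewrite mulr1.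
- by apply/seteqP; split=> // x [Ix x1]; case: I1; rewrite -x1.
- by exists c.
Qed.

End IdealCalculus.

(** * Local rings of dimension one *)

Section LocalRing.
Variable R : comNzRingType.
Implicit Types (I J P Q : set R) (a b x y r : R).
Variable m : set R.
Hypothesis noeth : is_noetherian R.
Hypothesis loc : is_local m.

Lemma max_ideal : is_ideal m. Proof. by case: loc => -[]. Qed.

Lemma max_not1 : ~ m 1. Proof. by case: loc => -[]. Qed.

(** A proper ideal that is maximal among proper ideals is m; otherwise a larger
    proper ideal is already contained in m. *)
Lemma proper_sub_max I : is_ideal I -> ~ I 1 -> I `<=` m.
Proof.
move: I; apply: (noeth_ind noeth) => I iI IH I1.
have [[J [iJ J1 IJ]]|noJ] := pselect (exists J, [/\ is_ideal J, ~ J 1 & I `<` J]).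
  by apply: (subset_trans (properW IJ)); exact: IH.
suff -> : I = m by [].
case: loc => _; apply; split=> // J iJ J1 IJ.
apply: contrapT => JI; apply: noJ; exists J; split=> //; split=> // JI'.
by apply: JI; exact/seteqP.
Qed.

Lemma unit_of_notin_max a : ~ m a -> exists b, b * a = 1.
Proof.
move=> ma; apply: contrapT => nb.
apply: ma; apply: (proper_sub_max (principal_ideal a)); last exact: principal_mem.
by rewrite principalE => -[b]; move=> e; apply: nb; exists b.
Qed.

Lemma unit_1sub a : m a -> exists b, b * (1 - a) = 1.
Proof.
move=> ma; apply: unit_of_notin_max => m1a; apply: max_not1.
by rewrite -(subrK a 1); apply: (idealD max_ideal).
Qed.

Lemma prime_ideal P : is_prime_ideal P -> is_ideal P. Proof. by case. Qed.

Lemma prime_sub_max P : is_prime_ideal P -> P `<=` m.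
Proof. by case=> iP P1 _; exact: proper_sub_max. Qed.

Lemma prime_exp P x n : is_prime_ideal P -> P (x ^+ n) -> P x.
Proof.
case=> _ P1 PM; elim: n => [/P1//|n IH].
by rewrite exprS => /PM[].
Qed.

Lemma max_prime : is_prime_ideal m.
Proof.
split; [exact: max_ideal|exact: max_not1|] => x y mxy.
have [|mx] := pselect (m x); [by left|right].
have [b bx] := unit_of_notin_max mx.
by rewrite -[y]mul1r -bx -mulrA; exact/(idealMl _ max_ideal).
Qed.

Lemma prime_of_exp_sub P i : is_prime_ideal P -> ideal_exp m i `<=` P -> P = m.
Proof.
move=> pP mP; apply/seteqP; split; first exact: prime_sub_max.
by move=> a ma; apply: (prime_exp (n := i)) => //; apply: mP; exact: ideal_expX.
Qed.

Lemma prime_escape P : is_prime_ideal P -> P <> m -> exists2 y, m y & ~ P y.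
Proof.
move=> pP Pm; apply: contrapT => /forall2NP mP; apply: Pm.
apply/seteqP; split; first exact: prime_sub_max.
by move=> y my; case: (mP y) => // /contrapT.
Qed.

(** If a b lies in I but a and b do not, then the product of the powers of m
    contained in I + (a) and in I + (b) is contained in I. *)
Lemma primary_of_primes I : is_ideal I ->
  (forall P, is_prime_ideal P -> I `<=` P -> P = m) ->
  exists i, ideal_exp m i `<=` I.
Proof.
move: I; apply: (noeth_ind noeth) => I iI IH Ip.
have [I1|I1] := pselect (I 1).
  by exists 0%N => z _; rewrite -[z]mulr1; exact: idealMl.
have [pI|nI] := pselect (is_prime_ideal I).
  by exists 1%N; rewrite (ideal_exp1 max_ideal) -(Ip I).
have [a [b [Iab Ia Ib]]] : exists a b, [/\ I (a * b), ~ I a & ~ I b].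
  apply: contrapT => nab; apply: nI; split=> // a b Iab.
  have [|Ia] := pselect (I a); [by left|right].
  by apply: contrapT => Ib; apply: nab; exists a, b.
have sub c : ~ I c -> exists i, ideal_exp m i `<=` adjoin I c.
  move=> Ic; apply: IH; [exact: adjoin_ideal|exact: proper_adjoin|].
  by move=> P pP IP; apply: Ip => //; apply: subset_trans IP; exact: sub_adjoin.
have [[i mi] [j mj]] := (sub _ Ia, sub _ Ib).
exists (i + j)%N => z /ideal_expD_sub; apply: ideal_mul_min => //.
move=> {}z t /mi[r Ir] /mj[s Is].
have -> : z * t = t * (z - r * a) + (r * a) * (t - s * b) + (r * s) * (a * b).
  by ring.
by apply: idealD => //; [apply: idealD => //|]; exact: idealMl.
Qed.

Lemma colon_max I s : is_ideal I -> ~ I s -> (forall a, m a -> I (a * s)) ->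
  colon I s = m.
Proof.
move=> iI Is ms; apply/seteqP; split=> [r Ir|a /ms //].
apply: contrapT => /unit_of_notin_max[b br]; apply: Is.
by rewrite -[s]mul1r -br -mulrA; exact: idealMl.
Qed.

Lemma parameter_regular x : is_parameter m x ->
  (forall s, (forall a, m a -> a * s = 0) -> s = 0) ->
  forall r, r * x = 0 -> r = 0.
Proof.
move=> [_ [i mi]] depth r rx; apply: contrapT => r0.
have [|s [sr0 msr]] := @socle_element R m _ r i (@ideal_set0 R) r0.
  move=> a /mi; rewrite principalE => -[b ->].
  by rewrite -mulrA (mulrC x) rx mulr0.
by apply: sr0; apply: depth.
Qed.

Hypothesis dim1 : krull_dim_eq R 1%N.

Lemma exists_nonmax_prime : exists2 P, is_prime_ideal P & P <> m.
Proof.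
have [P [pP ltP]] := dim1.1; exists (P 0%N); first exact: pP.
move=> P0m; have [_] := ltP 0%N isT; apply.
by rewrite P0m; apply: prime_sub_max; exact: pP.
Qed.

Lemma max_not_nilpotent i : ~ ideal_exp m i `<=` [set 0].
Proof.
have [P pP Pm] := exists_nonmax_prime.
move=> mi; apply: Pm; apply: (prime_of_exp_sub (i := i)) => // z /mi ->.
exact: (ideal0 (prime_ideal pP)).
Qed.

Lemma nonmax_prime_minimal P Q : is_prime_ideal P -> is_prime_ideal Q ->
  P `<=` Q -> Q <> m -> P = Q.
Proof.
move=> pP pQ PQ Qm; apply: contrapT => PQ'.
suff: (2 <= 1)%N by [].
apply: (dim1.2 2%N).
exists (fun i => if i is i'.+1 then if i' is 0%N then Q else m else P).
split=> [[|[|[]]]|[|[]]] //= _; first exact: max_prime.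
- by split=> // QP; apply: PQ'; exact/seteqP.
- split; first exact: prime_sub_max.
  by move=> mQ; apply: Qm; apply/seteqP; split=> //; exact: prime_sub_max.
Qed.

(** A parameter is an element of m lying in no other prime. If x lies in a
    prime P other than m, then P is minimal, so a power of x is killed by an
    element outside P, hence by some y in m outside P; adding y to that power
    gives an element that leaves P and enters no new prime. The intersection of
    the primes containing it has grown, so that the process stops. *)
Lemma exists_parameter : exists x, is_parameter m x.
Proof.
pose rad x : set R := [set z | forall P, is_prime_ideal P -> P x -> P z].
have irad x : is_ideal (rad x).
  split=> [P [iP _ _] _|y z Py Pz P pP Px|a z Pz P pP Px].
  - exact: ideal0.
  - by apply: (idealD (prime_ideal pP)); [exact: Py|exact: Pz].
  - by apply: (idealMl _ (prime_ideal pP)); exact: Pz.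
suff: forall I, is_ideal I -> forall x, m x -> rad x = I ->
    exists x, is_parameter m x.
  by move=> /(_ _ (irad 0)); apply; [exact: (ideal0 max_ideal)|].
apply: (noeth_ind noeth) => I _ IH x mx radx.
have [xm|] := pselect (forall P, is_prime_ideal P -> P x -> P = m).
  exists x; split=> //; apply: primary_of_primes; first exact: principal_ideal.
  by move=> P pP xP; apply: xm => //; apply: xP; exact: principal_mem.
move=> /existsNP[P /not_implyP[pP /not_implyP[Px Pm]]].
have iP := prime_ideal pP.
have [j [s [Ps xs]]] : exists j s, ~ P s /\ x ^+ j * s = 0.
  apply: contrapT => nj.
  have [|||c [pc cS]] := assoc_prime noeth
      (S := [set z | exists j s, ~ P s /\ z = x ^+ j * s]) (@ideal_set0 R).
  - by exists 0%N, 1; rewrite mulr1; split=> //; case: pP.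
  - move=> _ _ [j [s [Ps ->]]] [k [t [Pt ->]]].
    exists (j + k)%N, (s * t); split; last by rewrite exprD; ring.
    by case: pP => _ _ PM /PM[].
  - apply/seteqP; split=> // _ [-> [j [s [Ps e]]]].
    by apply: nj; exists j, s.
  have out z : colon [set 0] c z ->
      ~ exists j s, ~ P s /\ z = x ^+ j * s.
    move=> cz Sz; suff : (set0 : set R) z by [].
    by rewrite -cS.
  have cP : colon [set 0] c `<=` P.
    move=> z cz; apply: contrapT => Pz; apply: (out z cz).
    by exists 0%N, z; rewrite mul1r.
  have E := nonmax_prime_minimal pc pP cP Pm.
  apply: (out x); first by rewrite E.
  by exists 1%N, 1; rewrite mulr1; split=> //; case: pP.
have [z mz Pz] := prime_escape pP Pm.
pose y := s * z; pose x' := x ^+ j.+1 + y.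
have xy : x ^+ j.+1 * y = 0.
  have -> : x ^+ j.+1 * y = x * z * (x ^+ j * s) by rewrite exprS /y; ring.
  by rewrite xs mulr0.
have mx' : m x'.
  apply: (idealD max_ideal); last exact: (idealMl _ max_ideal).
  by rewrite exprS; exact: (idealMr _ max_ideal).
have Px' : ~ P x'.
  move=> Px'; have : P y.
    rewrite -[y](addKr (x ^+ j.+1)); apply: (idealD iP) => //.
    by apply: (idealN iP); rewrite exprS; exact: (idealMr _ iP).
  by case: pP => _ _ PM /PM[].
apply: (IH (rad x') (irad x') _ x' mx' erefl); rewrite -radx; split.
  move=> t rt Q pQ Qx'; apply: rt => //.
  apply: (prime_exp (n := j.+1 + j.+1)) => //; rewrite exprD.
  have -> : x ^+ j.+1 * x ^+ j.+1 = x ^+ j.+1 * x' by rewrite mulrDr xy addr0.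
  by apply: idealMl => //; exact: prime_ideal.
by move=> /(_ x') H; apply: Px'; apply: H.
Qed.

Lemma parameter_exp x i :
  is_parameter m x -> (0 < i)%N -> is_parameter m (x ^+ i).
Proof.
move=> [mx [k mk]]; case: i => // i _; split.
  by rewrite exprS; exact: (idealMr _ max_ideal).
by exists (i.+1 * k)%N; exact: principal_expX.
Qed.

Lemma parameter_neq0 x : is_parameter m x -> x <> 0.
Proof.
move=> [_ [i mi]] x0; apply: (@max_not_nilpotent i).
apply: (subset_trans mi); rewrite x0.
by apply: principal_sub => //; exact: ideal_set0.
Qed.

End LocalRing.

(** * Quotients and finite generation of modules *)

Section Modules.
Variable R : comNzRingType.
Implicit Types (V W : lmodType R).

Definition is_submod V (S : set V) : Prop :=
  [/\ S 0, forall u v, S u -> S v -> S (u + v) & forall a u, S u -> S (a *: u)].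

Lemma submod0 V (S : set V) : is_submod S -> S 0. Proof. by case. Qed.
Lemma submodD V (S : set V) u v : is_submod S -> S u -> S v -> S (u + v).
Proof. by case=> _ + _; apply. Qed.
Lemma submodZ V (S : set V) a u : is_submod S -> S u -> S (a *: u).
Proof. by case=> _ _; apply. Qed.
Lemma submodN V (S : set V) u : is_submod S -> S u -> S (- u).
Proof. by rewrite -scaleN1r; exact: submodZ. Qed.
Lemma submodB V (S : set V) u v : is_submod S -> S u -> S v -> S (u - v).
Proof. by move=> iS Su Sv; apply: submodD => //; exact: submodN. Qed.

Definition mk_linear V W (f : V -> W) (fL : linear f) : {linear V -> W} :=
  HB.pack f (GRing.isLinear.Build R V W *:%R f fL).

Lemma linZ (V W : lmodType R) (f : {linear V -> W}) a u : f (a *: u) = a *: f u.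
Proof. exact: linearZ. Qed.

Section Quotient.
Variables (V : lmodType R) (N : set V) (subN : is_submod N).

Let mem_N : {pred V} := [pred v | `[< N v >]].

Let mem_N_closed : zmod_closed mem_N.
Proof.
by split=> [|u v]; rewrite !inE; [exact: submod0|exact: submodB].
Qed.

Let zN : zmodClosed V :=
  HB.pack mem_N (GRing.isZmodClosed.Build V mem_N mem_N_closed).

Local Notation Q := (Quotient.quot zN).
Let pi (v : V) : Q := \pi_Q%qT v.

Let piE u v : pi u = pi v <-> N (u - v).
Proof.
split=> [/eqP|Nuv].
  by rewrite -Quotient.idealrBE inE.
by apply/eqP; rewrite -Quotient.idealrBE inE.
Qed.

Let piK (q : Q) : pi (repr q) = q. Proof. exact: reprK. Qed.

Let piD u v : pi (u + v) = pi u + pi v. Proof. exact: raddfD. Qed.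

Let scale a (q : Q) : Q := pi (a *: repr q).

Let piZ a v : pi (a *: v) = scale a (pi v).
Proof.
by apply/piE; rewrite -scalerBr; apply: submodZ => //; apply/piE; rewrite piK.
Qed.

Let scaleA a b q : scale a (scale b q) = scale (a * b) q.
Proof. by rewrite -[q]piK -!piZ scalerA. Qed.

Let scale1 : left_id 1 scale.
Proof. by move=> q; rewrite -[q]piK -piZ scale1r. Qed.

Let scaleDr : right_distributive scale +%R.
Proof.
by move=> a p q; rewrite -[p]piK -[q]piK -piD -!piZ -piD scalerDr.
Qed.

Let scaleDl q : {morph scale^~ q : a b / a + b}.
Proof. by move=> a b; rewrite -[q]piK -!piZ -piD scalerDl. Qed.

Lemma quotient_module : exists (W : lmodType R) (p : {linear V -> W}),
  (forall w, exists v, p v = w) /\ forall v, p v = 0 <-> N v.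
Proof.
pose W : lmodType R := HB.pack Q
  (GRing.Zmodule_isLmodule.Build R Q scaleA scale1 scaleDr scaleDl).
have piL : linear (pi : V -> W) by move=> a u v; rewrite piD piZ.
exists W, (mk_linear piL); split=> [w|v].
  by exists (repr (w : Q)); exact: piK.
have pi0 : pi 0 = 0 :> W by apply: (raddf0 (mk_linear piL)).
by split=> [/= |]; rewrite -pi0 /= piE subr0.
Qed.

End Quotient.

Section FiniteGeneration.
Variable V : lmodType R.
Implicit Types (B S : set V) (u v : V).

(** B + R v1 + ... + R vk for l = [v1; ...; vk]. *)
Fixpoint spanmod B (l : seq V) : set V :=
  if l is v :: l' then [set u | exists c, spanmod B l' (u - c *: v)] else B.

(** Finite generation of S modulo B. The generators are required to lie in S,
    because Nakayama's lemma applies its hypothesis to them. *)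
Definition fgmod B S :=
  exists l : seq V, (forall v, v \in l -> S v) /\ S `<=` spanmod B l.

Lemma spanmod_submod B l : is_submod B -> is_submod (spanmod B l).
Proof.
move=> iB; elim: l => // v l IH; split=> [|x y [c xc] [d yd]|a x [c xc]].
- by exists 0; rewrite scale0r subr0; exact: submod0.
- by exists (c + d); rewrite scalerDl opprD addrACA; exact: submodD.
- by exists (a * c); rewrite -scalerA -scalerBr; exact: submodZ.
Qed.

Lemma sub_spanmod B l : B `<=` spanmod B l.
Proof.
by elim: l => // v l IH u Bu; exists 0; rewrite scale0r subr0; exact: IH.
Qed.

Lemma spanmodS B B' l : B `<=` B' -> spanmod B l `<=` spanmod B' l.
Proof. by move=> BB'; elim: l => //= v l IH u [c uc]; exists c; exact: IH. Qed.

(** Only the images of S and S' modulo B' matter. *)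
Lemma fgmod_congr B B' S S' : is_submod B' -> B `<=` B' ->
  (forall v, S v -> exists2 u, S' u & B' (v - u)) ->
  (forall u, S' u -> exists2 v, S v & B' (u - v)) -> fgmod B S -> fgmod B' S'.
Proof.
move=> iB' BB' SS' S'S [l [lS Sl]].
have [l' [l'S' ll']] : exists l', (forall v, v \in l' -> S' v) /\
    spanmod B' l `<=` spanmod B' l'.
  elim: l lS {Sl} => [|v l IH] lS; first by exists [::]; split.
  have [w wl|l' [l'S' ll']] := IH; first by apply: lS; rewrite inE wl orbT.
  have [v' Sv' vv'] := SS' _ (lS _ (mem_head _ _)).
  exists (v' :: l'); split=> [w|u [c uc]].
    by rewrite inE => /orP[/eqP->//|/l'S'].
  exists c; have -> : u - c *: v' = (u - c *: v) + c *: (v - v').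
    by rewrite scalerBr addrA subrK.
  have iL := spanmod_submod l' iB'.
  apply: submodD; [exact: iL|exact: ll'|].
  by apply: submodZ => //; exact: sub_spanmod.
exists l'; split=> // u /S'S[v /Sl /(spanmodS BB') lv B'uv].
rewrite -(subrK v u); apply: submodD; first exact: spanmod_submod.
  exact: sub_spanmod.
exact: ll'.
Qed.

(** A generator h satisfies h = y v + b, where v involves h with some coefficient
    c; as 1 - y c is a unit, h can be dropped. *)
Lemma nakayama (m : set R) y B S :
  is_noetherian R -> is_local m -> m y -> is_submod B -> fgmod B S ->
  (forall u, S u -> exists2 v, S v & B (u - y *: v)) -> S `<=` B.
Proof.
move=> noeth loc my iB [l [lS Sl]] Sy; elim: l lS Sl => // h l IH lS Sl.
apply: IH => [v vl|u Su]; first by apply: lS; rewrite inE vl orbT.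
have iL := spanmod_submod l iB.
have [v Sv Bhv] := Sy h (lS _ (mem_head _ _)).
have [[c lvc] [d lud]] := (Sl _ Sv, Sl _ Su).
have [b b1] : exists b, b * (1 - y * c) = 1.
  by apply: (unit_1sub noeth loc); apply: idealMr => //; exact: max_ideal.
have lh : spanmod B l h.
  rewrite -[h]scale1r -b1 -scalerA; apply: submodZ => //.
  have -> : (1 - y * c) *: h = (h - y *: v) + y *: (v - c *: h).
    by rewrite scalerBl scale1r scalerBr scalerA addrA subrK.
  by apply: submodD => //; [exact: sub_spanmod|exact: submodZ].
by rewrite -(subrK (d *: h) u); apply: submodD => //; exact: submodZ.
Qed.

End FiniteGeneration.

Lemma fgmod_image V W (g : {linear V -> W}) (B S : set V) (C : set W) :
  is_submod C -> (forall b, B b -> C (g b)) -> fgmod B S -> fgmod C (g @` S).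
Proof.
move=> iC BC [l [lS Sl]]; exists (map g l); split.
  by move=> _ /mapP[v vl ->]; exists v => //; exact: lS.
move=> _ [u /Sl + <-]; elim: l u {lS Sl} => [u /BC //|v l IH u [c uc]].
by exists c; rewrite -linearZ -linearB; exact: IH.
Qed.

(** Finite generation of the two ends of a filtration step: generators of the
    image of S under g, lifted to S, together with generators of its kernel. *)
Lemma fgmod_ext V W (g : {linear V -> W}) (B S : set V) (C : set W) :
  is_submod S -> fgmod C (g @` S) -> fgmod B (S `&` g @^-1` C) -> fgmod B S.
Proof.
move=> iS [l1 [l1S Sl1]] [l2 [l2S Sl2]].
have [l [lS ?]] : exists l, (forall v, v \in l -> S v) /\ map g l = l1.
  elim: l1 l1S {Sl1} => [|w l1 IH] l1S; first by exists [::].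
  have [w' wl|l [lS lg]] := IH; first by apply: l1S; rewrite inE wl orbT.
  have [v Sv gv] := l1S w (mem_head _ _).
  exists (v :: l); split=> [v'|/=]; last by rewrite gv lg.
  by rewrite inE => /orP[/eqP->//|/lS].
subst l1; exists (l ++ l2); split=> [v|u Su].
  by rewrite mem_cat => /orP[/lS //|/l2S []].
have : spanmod C (map g l) (g u) by apply: Sl1; exists u.
elim: l u Su lS {l1S Sl1} => [u Su _ Cu|v l IH u Su lS [c uc]]; first exact: Sl2.
exists c; apply: IH; last by rewrite linearB linearZ.
- by apply: submodB => //; apply: submodZ => //; apply: lS; exact: mem_head.
- by move=> w wl; apply: lS; rewrite inE wl orbT.
Qed.

Lemma fgmod_ideal (I : set R) : is_noetherian R -> is_ideal I ->
  @fgmod R^o [set 0] I.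
Proof.
move=> noeth iI; apply: (ideal_ind_up noeth iI); first by exists [::]; split.
move=> J a iJ _ _ [l [lJ Jl]]; exists (a :: l); split=> [b|u [r Jr]].
  rewrite inE => /orP[/eqP->|/lJ Jb]; first exact: adjoin_mem.
  exact: (@sub_adjoin R _ a _ Jb).
by exists r; exact: Jl.
Qed.

End Modules.

(** * Injective modules *)

Section Injectives.
Variable R : comNzRingType.

Definition annih (E : lmodType R) (I : set R) : set E :=
  [set u | forall r, I r -> r *: u = 0].

Lemma annih_submod (E : lmodType R) (I : set R) : is_submod (annih (E := E) I).
Proof.
split=> [r _|u v Iu Iv r Ir|a u Iu r Ir]; first by rewrite scaler0.
- by rewrite scalerDr Iu // Iv // addr0.
- by rewrite scalerA mulrC -scalerA Iu // scaler0.
Qed.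

Lemma annihS (E : lmodType R) (I J : set R) : I `<=` J ->
  annih (E := E) J `<=` annih I.
Proof. by move=> IJ u Ju r /IJ; exact: Ju. Qed.

Lemma annih_adjoin (E : lmodType R) (I : set R) a (u : E) :
  annih I u -> a *: u = 0 -> annih (adjoin I a) u.
Proof.
move=> Iu au r [s Is]; rewrite -(subrK (s * a) r) scalerDl Iu // add0r.
by rewrite -scalerA au scaler0.
Qed.

Lemma factor_quotient (V W X : lmodType R) (p : {linear V -> W})
    (g : {linear V -> X}) :
  (forall w, exists v, p v = w) -> (forall v, p v = 0 -> g v = 0) ->
  exists h : {linear W -> X}, forall v, h (p v) = g v.
Proof.
move=> surj ker; pose s w := projT1 (cid (surj w)).
have ps w : p (s w) = w by rewrite /s; case: cid.
have gp u v : p u = p v -> g u = g v.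
  move=> /eqP; rewrite -subr_eq0 -linearB => /eqP /ker /eqP.
  by rewrite linearB subr_eq0 => /eqP.
have hL : linear (g \o s).
  by move=> a u v /=; rewrite -linearP; apply: gp; rewrite linearP !ps.
by exists (mk_linear hL) => v /=; apply: gp; rewrite ps.
Qed.

Lemma scale_linear (E : lmodType R) (u : E) :
  exists h : {linear R^o -> E}, forall r, h r = r *: u.
Proof.
have hL : linear (fun r : R^o => r *: u).
  by move=> a r s; rewrite scalerDl scalerA.
by exists (mk_linear hL).
Qed.

(** Divisibility in an injective module E: maps from R/(I : a) to E extend
    along multiplication by a, which embeds R/(I : a) into R/I. *)
Lemma injective_divisible (E : lmodType R) : injective_module E ->
  forall (I : set R) a (u : E), is_ideal I -> annih (colon I a) u ->
  exists2 v, annih I v & a *: v = u.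
Proof.
move=> injE I a u iI Iu.
have sub J : is_ideal J -> @is_submod R R^o J by case.
have [A [p [ps pk]]] := quotient_module (sub _ (colon_ideal a iI)).
have [B [q [qs qk]]] := quotient_module (sub _ iI).
have [g gE] := scale_linear (q a).
have [f fE] : exists f : {linear A -> B}, forall r, f (p r) = g r.
  apply: factor_quotient => // r /pk Ir.
  by rewrite gE -linearZ; apply/qk.
have [t tE] := scale_linear u.
have [t' t'E] : exists t' : {linear A -> E}, forall r, t' (p r) = t r.
  by apply: factor_quotient => // r /pk Ir; rewrite tE; exact: Iu.
have injf : injective f.
  move=> x y /eqP; rewrite -subr_eq0 -linearB => /eqP.
  have [r rE] := ps (x - y); rewrite -rE fE gE -linearZ => /qk Ir.
  by apply/eqP; rewrite -subr_eq0 -rE; apply/eqP/pk.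
have [h hE] := injE _ _ f t' injf.
exists (h (q 1)) => [r Ir|].
  have /qk q1 : I (r *: (1 : R^o)) by rewrite [_ *: _]mulr1.
  by rewrite -2!linearZ q1 linear0.
have := hE (p 1); rewrite fE gE t'E tE !scale1r => <-.
by rewrite -2!linearZ /= [_ *: _]mulr1.
Qed.

End Injectives.

(** * Vanishing of Ext and the socle of a Gorenstein ring *)

Section Ext.
Variables (R : comNzRingType) (m : set R).
Hypotheses (noeth : is_noetherian R) (loc : is_local m).
Variables (M : nat -> lmodType R) (e : {linear R^o -> M 0%N}).
Variable d : forall i, {linear M i -> M i.+1}.
Arguments d : clear implicits.
Hypothesis injM : forall i, injective_module (M i).
Arguments injM : clear implicits.
Hypothesis inj_e : injective e.
Hypothesis exact0 : range e = d 0%N @^-1` [set 0].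
Hypothesis exactS : forall i, range (d i) = d i.+1 @^-1` [set 0].
Implicit Types (I J P : set R) (a s x y r : R).

(** Cocycles and coboundaries for Ext^i(R/I, R): a map from R/I to M i is an
    element of M i killed by I. *)
Definition Zext i I : set (M i) := [set u | annih I u /\ d i u = 0].

Arguments Zext : clear implicits.

Definition Bext i I : set (M i) :=
  match i return set (M i) with
  | 0%N => [set 0]
  | j.+1 => [set u | exists2 w, annih I w & u = d j w]
  end.

Arguments Bext : clear implicits.

(** The vanishing of Ext^i(R/I, R). *)
Definition ext0 i I : Prop := Zext i I `<=` Bext i I.

Lemma d_e r : d 0%N (e r) = 0.
Proof. by have : (range e) (e r) by []; rewrite exact0. Qed.

Lemma ker_d0 u : d 0%N u = 0 -> exists r : R, u = e r.
Proof.
move=> du; suff [r _ <-] : range e u by exists r.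
by rewrite exact0.
Qed.

Lemma d_d i u : d i.+1 (d i u) = 0.
Proof. by have : (range (d i)) (d i u) by []; rewrite exactS. Qed.

Lemma ker_dS i u : d i.+1 u = 0 -> exists v, u = d i v.
Proof.
move=> du; suff [r _ <-] : range (d i) u by exists r.
by rewrite exactS.
Qed.

Lemma eM a r : e (a * r) = a *: e r.
Proof. exact: linearZ. Qed.

Lemma Zext_submod i I : is_submod (Zext i I).
Proof.
have iA := annih_submod (M i) I; split=> [|u v [Iu du] [Iv dv]|a u [Iu du]].
- by split; [exact: (submod0 iA)|rewrite linear0].
- by split; [exact: (submodD iA)|rewrite linearD du dv addr0].
- by split; [exact: (submodZ _ iA)|rewrite linearZ_LR /= du scaler0].
Qed.

Lemma Bext_submod i I : is_submod (Bext i I).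
Proof.
case: i => [|i] /=.
  by split=> [|u v -> ->|a u ->] //=; rewrite ?addr0 ?scaler0.
have iA := annih_submod (M i) I; split=> [|_ _ [u Iu ->] [v Iv ->]|a _ [u Iu ->]].
- by exists 0; [exact: (submod0 iA)|rewrite linear0].
- by exists (u + v); [exact: (submodD iA)|rewrite linearD].
- by exists (a *: u); [exact: (submodZ _ iA)|rewrite linearZ].
Qed.

Lemma Bext_sub_Zext i I : Bext i I `<=` Zext i I.
Proof.
case: i => [_ ->|i _ [w Iw ->]].
  by split; [exact: (submod0 (annih_submod _ _))|rewrite linear0].
split; last exact: d_d.
by move=> r Ir; rewrite -linearZ Iw // linear0.
Qed.

Lemma BextS i I J : I `<=` J -> Bext i J `<=` Bext i I.
Proof.
by case: i => [|i] IJ u // -[w Jw ->]; exists w => //; exact: (annihS IJ).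
Qed.

Lemma Bext_scale i I a v : Bext i I v -> Bext i (colon I a) (a *: v).
Proof.
case: i v => [v ->|i _ [w Iw ->]]; first by rewrite scaler0.
exists (a *: w); last by rewrite linearZ.
by move=> r Ir; rewrite scalerA Iw.
Qed.

Lemma Bext_divisible i I a u : is_ideal I -> Bext i (colon I a) u ->
  exists2 v, Bext i I v & a *: v = u.
Proof.
case: i u => [_ _ ->|i _ iI [w Iw ->]].
  by exists 0 => //; rewrite scaler0.
have [w' Iw' <-] := injective_divisible (injM i) iI Iw.
by exists (d i w'); [exists w'|rewrite linearZ].
Qed.

(** Surjectivity of Ext^i(R/I) -> Ext^i(R/(I : a)), from the long exact
    sequence of 0 -> R/(I : a) -> R/I -> R/(I + (a)) -> 0. *)
Lemma ext_lift i I a u : is_ideal I -> ext0 i.+1 (adjoin I a) ->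
  Zext i (colon I a) u -> exists2 v, Zext i I v & a *: v = u.
Proof.
move=> iI E [Iu du]; have [v Iv av] := injective_divisible (injM i) iI Iu.
have [|w Iw dw] := E (d i v).
  split; last exact: d_d.
  apply: annih_adjoin; last by rewrite -linearZ av.
  by move=> r Ir; rewrite -linearZ Iv // linear0.
exists (v - w).
  split; last by rewrite linearB dw subrr.
  apply: (submodB (annih_submod _ _)) => //; apply: annihS Iw; exact: sub_adjoin.
by rewrite scalerBr av Iw ?subr0 //; exact: adjoin_mem.
Qed.

(** Exactness of the same sequence in the middle. *)
Lemma ext0_devissage i I a : is_ideal I -> ext0 i (colon I a) ->
  ext0 i (adjoin I a) -> ext0 i I.
Proof.
move=> iI Ec Ea u [Iu du].
have /Ec /(Bext_divisible iI) [v Bv av] : Zext i (colon I a) (a *: u).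
  split; last by rewrite linearZ_LR /= du scaler0.
  by move=> r Ir; rewrite scalerA Iu.
rewrite -(subrK v u); apply: (submodD (Bext_submod _ _)) => //.
apply: (BextS (@sub_adjoin _ _ a)); apply: Ea.
have Zu : Zext i I (u - v).
  by apply: (submodB (Zext_submod _ _)) => //; exact: Bext_sub_Zext.
split; last by case: Zu.
by apply: annih_adjoin; [case: Zu|rewrite scalerBr av subrr].
Qed.

(** Every nonzero R/I contains some R/P with P prime, so primes are enough by
    noetherian induction. *)
Lemma ext0_of_primes i I0 : is_ideal I0 ->
  (forall P, is_prime_ideal P -> I0 `<=` P -> ext0 i P) ->
  forall I, is_ideal I -> I0 `<=` I -> ext0 i I.
Proof.
move=> iI0 EP; apply: (noeth_ind noeth) => I iI IH I0I.
have [I1|I1] := pselect (I 1).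
  move=> u [Iu du]; have -> : u = 0 by rewrite -[u]scale1r Iu.
  exact: (submod0 (Bext_submod _ _)).
have [c pc] := assoc_prime1 noeth iI I1.
have Ic : ~ I c by case: pc => _ + _; rewrite /colon /= mul1r.
apply: (ext0_devissage (a := c)) => //.
  by apply: EP => //; apply: (subset_trans I0I); exact: sub_colon.
apply: IH; [exact: adjoin_ideal|exact: proper_adjoin|].
by apply: (subset_trans I0I); exact: sub_adjoin.
Qed.

(** Ext^i(R/I, R) is a noetherian module. A class of degree i + 1 is d v for
    some v, which acts on I by degree i cocycles; it is determined, up to
    coboundaries, by its values on generators of I, one at a time. *)
Lemma ext_fg i I S : is_ideal I -> is_submod S -> Bext i I `<=` S ->
  S `<=` Zext i I -> fgmod (Bext i I) S.
Proof.
elim: i I S => [|i IHi] I S iI iS BS SZ.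
  have iJ : is_ideal [set r : R | S (e r)].
    split=> [|r s Sr Ss|a r Sr] /=.
    - by rewrite linear0; exact: submod0.
    - by rewrite linearD; exact: submodD.
    - by rewrite [e _](linearZ_LR e a r); exact: submodZ.
  have -> : S = e @` [set r : R | S (e r)].
    apply/seteqP; split=> [u Su|_ [r Sr <-] //].
    have [_ du] := SZ _ Su; have [r ur] := ker_d0 du.
    by exists r => //=; rewrite -ur.
  apply: fgmod_image (fgmod_ideal noeth iJ); first exact: (Bext_submod 0 I).
  by move=> _ -> /=; rewrite linear0.
(* S is the image of T, and D is what has to be ignored in T. Going through the
   generators a of I, the elements of T that kill J are filtered by their product
   with a, which is a degree i cocycle for (J : a). *)
pose T : set (M i) := [set v | S (d i v)].
pose D : set (M i) := [set v | Bext i.+1 I (d i v)].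
have iT : is_submod T.
  split=> [|u v Tu Tv|a u Tu]; rewrite /T /=.
  - by rewrite linear0; exact: submod0.
  - by rewrite linearD; exact: submodD.
  - by rewrite linearZ; exact: submodZ.
have iD : is_submod D.
  have iB := Bext_submod i.+1 I.
  split=> [|u v Tu Tv|a u Tu]; rewrite /D; red.
  - by rewrite linear0; exact: (submod0 iB).
  - by rewrite linearD; exact: (submodD iB).
  - by rewrite linearZ; exact: (submodZ _ iB).
have -> : S = d i @` T.
  apply/seteqP; split=> [u Su|_ [r Sr <-] //].
  have [_ /ker_dS[v uv]] := SZ _ Su.
  by exists v => //; rewrite /T /= -uv.
apply: (@fgmod_image R _ _ (d i) D) => //; first exact: Bext_submod.
suff H : fgmod D (T `&` annih [set 0]).
  move: H; congr fgmod; apply/seteqP; split=> [u [] //|u Tu]; split=> // _ ->.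
  by rewrite scale0r.
apply: (ideal_ind_down noeth (I := I)
  (P := fun J => fgmod D (T `&` annih J))) => // [|J a iJ JI Ia IHJ||]; last 2 first.
- exact: ideal_set0.
- by move=> _ ->; exact: ideal0.
- by exists [::]; split=> // u [_ Iu]; exists u.
have iTJ : is_submod (T `&` annih J).
  have iA := annih_submod (M i) J.
  split=> [|u v [Tu Ju] [Tv Jv]|b u [Tu Ju]].
  - by split; [exact: (submod0 iT)|exact: (submod0 iA)].
  - by split; [exact: (submodD iT)|exact: (submodD iA)].
  - by split; [exact: (submodZ _ iT)|exact: (submodZ _ iA)].
have aL : linear (fun v : M i => a *: v).
  by move=> c u v; rewrite scalerDr !scalerA mulrC.
have [g gE] : exists g : {linear M i -> M i}, forall v, g v = a *: v.
  by exists (mk_linear aL).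
have iC := Bext_submod i (colon J a).
apply: (fgmod_ext (g := g) (C := Bext i (colon J a))) => //.
  (* The induction hypothesis wants a module between coboundaries and cocycles,
     so the coboundaries are added to the image of g. *)
  pose S' := [set z | exists2 v, (T `&` annih J) v
    & Bext i (colon J a) (z - g v)].
  have iS' : is_submod S'.
    split=> [|y z [u Tu yu] [v Tv zv]|b y [u Tu yu]].
    - exists 0; first exact: submod0.
      by rewrite linear0 subr0; exact: submod0.
    - exists (u + v); first exact: submodD.
      by rewrite linearD opprD addrACA; exact: submodD.
    - exists (b *: u); first exact: submodZ.
      by rewrite linearZ_LR -scalerBr; exact: submodZ.
  have fgS' : fgmod (Bext i (colon J a)) S'.
    apply: IHi => //; first exact: colon_ideal.
    by move=> z Bz; exists 0; [exact: submod0|rewrite linear0 subr0].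
    move=> z [v [Tv Jv] Bz]; rewrite -(subrK (g v) z).
    apply: (submodD (Zext_submod _ _)); first exact: Bext_sub_Zext.
    split; first by move=> r Jr; rewrite gE scalerA Jv.
    have [+ _] := SZ _ Tv => /(_ _ Ia).
    by rewrite gE -linearZ.
  apply: fgmod_congr fgS' => // [z [v Tv Bz]|_ [v Tv <-]].
    by exists (g v) => //; exists v.
  exists (g v); last by rewrite subrr; exact: submod0.
  by exists v => //; rewrite subrr; exact: submod0.
apply: fgmod_congr IHJ => // [u [Tu Ju]|u [[Tu Ju]] Bu].
  exists u; last by rewrite subrr; exact: submod0.
  split; first by split=> //; apply: annihS Ju; exact: sub_adjoin.
  by rewrite /= gE (Ju a (adjoin_mem a iJ)); exact: submod0.
move: Bu; rewrite /= gE => /(Bext_divisible iJ)[v Bv av].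
have [Jv dv] := Bext_sub_Zext Bv.
exists (u - v).
  split; first by rewrite /T /= linearB dv subr0.
  apply: annih_adjoin; last by rewrite scalerBr av subrr.
  by apply: (submodB (annih_submod _ _)).
by rewrite opprB addrC subrK /D /mkset dv; exact: (submod0 (Bext_submod _ _)).
Qed.

Variable N : nat.
Hypothesis M_bounded : forall i, (N < i)%N -> forall u : M i, u = 0.

(** If m is the annihilator of an element of R/I0 and Ext^i(R/I0, R) vanishes
    for all i >= j, then Ext^i(R/I, R) vanishes for all i >= j and all I
    containing I0. By descending induction on i: the class of degree i of R/m
    lifts to R/I0, so it is zero; for a prime P other than m and y in m outside
    P, multiplication by y is surjective on Ext^i(R/P, R), which is finitely
    generated, so Nakayama's lemma applies; primes are enough. *)
Lemma ext0_vanish I0 s j : is_ideal I0 -> colon I0 s = m ->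
  (forall i, (j <= i)%N -> ext0 i I0) ->
  forall i, (j <= i)%N -> forall I, is_ideal I -> I0 `<=` I -> ext0 i I.
Proof.
move=> iI0 I0s E0 i.
have [k] : exists k, (N < i + k)%N by exists N.+1; rewrite addnS ltnS leq_addl.
elim: k i => [|k IH] i Nik ji.
  rewrite addn0 in Nik => I _ _ u _; rewrite (M_bounded Nik u).
  exact: (submod0 (Bext_submod _ _)).
have {}IH I : is_ideal I -> I0 `<=` I -> ext0 i.+1 I.
  by apply: IH; [rewrite addSnnS|exact: leqW].
apply: ext0_of_primes => // P pP I0P; have iP := prime_ideal pP.
have [->|Pm] := pselect (P = m).
  rewrite -I0s => u /ext_lift[]//.
    by apply: IH; [exact: adjoin_ideal|exact: sub_adjoin].
  by move=> v /(E0 _ ji) Bv <-; exact: Bext_scale.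
have [y my Py] := prime_escape noeth loc pP Pm.
apply: (nakayama noeth loc my (Bext_submod _ _)).
  by apply: ext_fg => //; [exact: Zext_submod|exact: Bext_sub_Zext].
move=> u Zu; have [||v Zv yv] := @ext_lift i P y u iP.
- apply: IH; first exact: adjoin_ideal.
  by apply: (subset_trans I0P); exact: sub_adjoin.
- suff -> : colon P y = P by [].
  apply/seteqP; split; last exact: sub_colon.
  by move=> r; case: pP => _ _ PM /PM[].
- by exists v => //; rewrite yv subrr; exact: (submod0 (Bext_submod _ _)).
Qed.

Lemma ext0_zero i : ext0 i.+1 [set 0].
Proof.
move=> u [_ /ker_dS[v ->]]; exists v => // _ ->.
by rewrite scale0r.
Qed.

(** Otherwise Ext^1 vanishes on all R/I, so that for primes Q other than m,
    multiplication by any y in m outside Q is surjective on (0 : Q), the group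
    Ext^0(R/Q, R), which is zero by Nakayama's lemma. But if P is a prime other
    than m, some nonzero c has a prime annihilator Q contained in P. *)
Lemma depth_pos s : krull_dim_eq R 1%N -> (forall a, m a -> a * s = 0) -> s = 0.
Proof.
move=> dim1 ms; apply: contrapT => s0.
have cs : colon [set 0] s = m by exact: (colon_max noeth loc (@ideal_set0 R)).
have E I : is_ideal I -> ext0 1 I.
  move=> iI; apply: (ext0_vanish (@ideal_set0 R) cs (j := 1%N)) => //.
    by case=> // i _; exact: ext0_zero.
  by move=> _ ->; exact: ideal0.
have [P pP Pm] := exists_nonmax_prime noeth loc dim1.
have [|||c [pc cS]] := assoc_prime noeth (S := ~` P) (@ideal_set0 R).
- by case: pP.
- by move=> r t Pr Pt; case: pP => _ _ PM /PM[].
- by apply/seteqP; split=> // _ [->]; case; exact: (ideal0 (prime_ideal pP)).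
set Q := colon [set 0] c in pc cS.
have QP : Q `<=` P.
  move=> z Qz; apply: contrapT => Pz.
  by suff : (set0 : set R) z by []; rewrite -cS.
have iQ := prime_ideal pc.
have Qm : Q <> m.
  move=> Qm; apply: Pm; apply/seteqP; split; last by rewrite -Qm.
  exact: (prime_sub_max noeth loc).
have [y my Qy] := prime_escape noeth loc pc Qm.
have Z0 : Zext 0 Q `<=` Bext 0 Q.
  apply: (nakayama noeth loc my (Bext_submod _ _)).
    by apply: ext_fg => //; [exact: Zext_submod|exact: Bext_sub_Zext].
  move=> u Zu; have [||v Zv yv] := @ext_lift 0 Q y u iQ.
  - by apply: E; exact: adjoin_ideal.
  - suff -> : colon Q y = Q by [].
    apply/seteqP; split; last exact: sub_colon.
    by move=> r; case: pc => _ _ PM /PM[].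
  - by exists v => //; rewrite yv subrr.
have ec : e c = 0.
  apply: Z0; split; last exact: d_e.
  move=> r Qr; rewrite -linearZ; have -> : r *: (c : R^o) = 0 by [].
  by rewrite linear0.
have c0 : c = 0 by apply: inj_e; rewrite ec linear0.
by case: pc => _ + _; rewrite /Q /colon /= c0 mulr0.
Qed.

Section RegularElement.
Variable x : R.
Hypothesis x_reg : forall r, r * x = 0 -> r = 0.

Lemma divisible_by_regular i (w : M i) : exists w', x *: w' = w.
Proof.
have [|v _ xv] := @injective_divisible _ _ (injM i) [set 0] x w (@ideal_set0 R).
  by move=> r /x_reg ->; rewrite scale0r.
by exists v.
Qed.

Lemma annih_principal i (u : M i) : x *: u = 0 -> annih (principal x) u.
Proof.
by move=> xu r; rewrite principalE => -[s ->]; rewrite -scalerA xu scaler0.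
Qed.

(** Multiplication by x gives 0 -> R -> R -> R/(x) -> 0, so that R/(x) has
    projective dimension one. *)
Lemma ext0_principal i : ext0 i.+2 (principal x).
Proof.
move=> u [xu /ker_dS[v uE]]; subst u.
have [w xv] : exists w, x *: v = d i w.
  by apply: ker_dS; rewrite linearZ; apply: xu; exact: principal_mem.
have [w' xw'] := divisible_by_regular w.
exists (v - d i w'); last by rewrite linearB d_d subr0.
by apply: annih_principal; rewrite scalerBr -linearZ xw' xv subrr.
Qed.

(** With v0 a solution of x v0 = e 1 (that is, v0 = 1/x), the class d v0 generates
    Ext^1(R/(x), R) = R/(x). An element t of the socle of R/(x) gives the class
    t (d v0) of Ext^1(R/m, R), and the latter group is s Ext^1(R/(x), R) since
    Ext^2 vanishes. *)
Lemma socle_cyclic s t : colon (principal x) s = m ->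
  (forall a, m a -> principal x (a * t)) ->
  exists r, principal x (t - r * s).
Proof.
move=> xs mt; have iX := principal_ideal x.
have E I : is_ideal I -> principal x `<=` I -> ext0 2 I.
  apply: (ext0_vanish iX xs (j := 2%N)) => //.
  by case=> [|[|i]] // _; exact: ext0_principal.
have [v0 xv0] := divisible_by_regular (e 1).
have [||v [xv dv] sv] := @ext_lift 1 (principal x) s (t *: d 0%N v0) iX.
- by apply: E; [exact: adjoin_ideal|exact: sub_adjoin].
- split; last by rewrite linearZ_LR /= d_d scaler0.
  move=> a; rewrite xs => ma; rewrite scalerA.
  have := mt a ma; rewrite principalE => -[b ->].
  by rewrite -scalerA -[x *: _]linearZ xv0 d_e scaler0.
have [w vE] := ker_dS dv; subst v.
have [r xw] : exists r, x *: w = e r.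
  by apply: ker_d0; rewrite linearZ; apply: xv; exact: principal_mem.
have [b bE] : exists b, t *: v0 - s *: w = e b.
  by apply: ker_d0; rewrite linearB (linZ (d 0%N) t) (linZ (d 0%N) s) sv subrr.
exists r; rewrite principalE; exists b; apply: inj_e.
have := congr1 (fun u => x *: u) bE.
rewrite scalerBr !scalerA (mulrC x t) (mulrC x s) -!scalerA xv0 xw -!eM mulr1.
by rewrite -linearB (mulrC r) (mulrC b).
Qed.

End RegularElement.

(** Two ideals strictly containing (x) both contain a nonzero element of the
    socle of R/(x), hence all of it. *)
Theorem parameter_irreducible x : krull_dim_eq R 1%N -> is_parameter m x ->
  irreducible_ideal (principal x).
Proof.
move=> dim1 px; have iX := principal_ideal x.
have x_reg r : r * x = 0 -> r = 0.
  apply: (parameter_regular px) => s ms.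
  exact: depth_pos.
have [mx [i mi]] := px.
have x1 : ~ principal x 1.
  move=> x1; apply: (max_not1 loc).
  by apply: (principal_sub (max_ideal loc) mx).
have sub1 (a : R) : ideal_exp m i a -> principal x (a * 1).
  by rewrite mulr1; exact: mi.
have [s' [xs ms]] := socle_element iX x1 sub1.
set s := s' * 1 in xs ms.
have cs : colon (principal x) s = m by exact: (colon_max noeth loc iX).
split=> // -[b [c [ib ic xb xc xE]]].
have mem_s (q : set R) : is_ideal q -> principal x `<` q -> q s.
  move=> iq [xq /existsNP[t /not_implyP[qt xt]]].
  have [|r [xr mr]] := @socle_element R m (principal x) t i iX xt.
    by move=> a /mi xa; exact: (idealMr _ iX).
  have [p xp] := socle_cyclic x_reg cs mr.
  have mp : ~ m p.
    move=> mp; apply: xr; have xps : principal x (p * s) by exact: ms.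
    by move: (idealD iX xp xps); rewrite subrK.
  have [p' p'p] := unit_of_notin_max noeth loc mp.
  have -> : s = p' * (r * t) - p' * (r * t - p * s).
    by rewrite -[LHS]mul1r -p'p; ring.
  by apply: (idealB iq); apply: (idealMl _ iq); [exact: idealMl|exact: xq].
by apply: xs; rewrite xE; split; exact: mem_s.
Qed.

End Ext.

(** * Duality over artinian rings with simple socle *)

Lemma nat_inf_mem (S : set nat) i : S i -> S (nat_inf S).
Proof.
move=> Si; have exS : exists i, `[< S i >] by exists i; apply/asboolP.
have [j /asboolP Sj jmin] := ex_minnP exS.
suff [] : [set i | S i /\ forall j, S j -> (i <= j)%N] (nat_inf S) by [].
apply: (@xgetI _ _ _ j); split=> // k Sk; apply: jmin; exact/asboolP.
Qed.

Section Artinian.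
Variables (R : comNzRingType) (m : set R).
Hypotheses (noeth : is_noetherian R) (loc : is_local m).
Implicit Types (I J C D : set R) (a b r s t x z : R).

Lemma colon_stable I x : is_ideal I ->
  exists n, forall k, colon I (x ^+ (n + k)) = colon I (x ^+ n).
Proof.
move=> iI.
have [|| _ [[n ->] nmax]] := noeth_max noeth
    (F := [set J | exists n, J = colon I (x ^+ n)]).
- by move=> _ [n ->]; exact: colon_ideal.
- by exists (colon I (x ^+ 0)), 0%N.
- exists n => k; apply: nmax; first by exists (n + k)%N.
  by move=> r; rewrite /colon /= exprD mulrA; exact: idealMr.
Qed.

(** If (0 : x^n) is the stable value of the annihilators of powers of x, then it
    is Gamma, and it meets (x^n) trivially; a power of m is contained in (x^n). *)
Lemma g_inv_spec x : is_parameter m x ->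
  ideal_exp m (g_inv m) `&` Gamma m = [set 0].
Proof.
move=> [mx [j mj]].
have [n stab] := colon_stable x (@ideal_set0 R).
apply: (@nat_inf_mem [set i | ideal_exp m i `&` Gamma m = [set 0]] (n * j)).
apply/seteqP; split=> [r [/(principal_expX mj)]|_ ->]; last first.
  split; first exact: (ideal0 (ideal_exp_ideal _ _)).
  by exists 0%N => a _; rewrite mulr0.
rewrite principalE => -[b ->] [i mi].
have /(_ b) : colon [set 0] (x ^+ (n + (n + i))) `<=` colon [set 0] (x ^+ n).
  by rewrite stab.
apply; rewrite /colon /= exprD exprD; have := mi _ (ideal_expX i mx).
by move=> E; rewrite -[RHS](mulr0 (x ^+ n)) -E; ring.
Qed.

(** The socle of R/J is simple and generated by the class of s. *)
Definition socle_gen J s : Prop :=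
  [/\ ~ J s, forall a, m a -> J (a * s)
    & forall t, (forall a, m a -> J (a * t)) -> exists r, J (t - r * s)].

(** A simple module is generated by any of its nonzero elements. *)
Lemma socle_gen_change J s s' : is_ideal J -> socle_gen J s ->
  ~ J s' -> (forall a, m a -> J (a * s')) -> socle_gen J s'.
Proof.
move=> iJ [Js ms gens] Js' ms'; split=> // t /gens[r Jt].
have [p Jp] := gens _ ms'.
have mp : ~ m p.
  by move=> mp; apply: Js'; move: (idealD iJ Jp (ms _ mp)); rewrite subrK.
have [q qp] := unit_of_notin_max noeth loc mp.
exists (r * q).
have -> : t - r * q * s' =
    (t - r * s) - r * q * (s' - p * s) + r * (1 - q * p) * s.
  by ring.
rewrite qp subrr mulr0 mul0r addr0.
by apply: idealB => //; exact: idealMl.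
Qed.

(** If t is in the socle but not in J + (s), then J + (s) and J + (t) intersect
    in J. *)
Lemma irreducible_socle J i : is_ideal J -> ~ J 1 -> ideal_exp m i `<=` J ->
  irreducible_ideal J -> exists s, socle_gen J s.
Proof.
move=> iJ J1 mi [_ irr].
have [|s' []] := @socle_element R m J 1 i iJ J1.
  by move=> a /mi; rewrite mulr1.
set s := s' * 1 => Js ms; exists s; split=> // t mt.
apply: contrapT => nt; apply: irr.
have Jt : ~ J t by move=> Jt; apply: nt; exists 0; rewrite mul0r subr0.
exists (adjoin J s), (adjoin J t); split.
- exact: adjoin_ideal.
- exact: adjoin_ideal.
- exact: proper_adjoin.
- exact: proper_adjoin.
apply/seteqP; split=> [z Jz|z [[r zs] [q zt]]]; first by split; exact: sub_adjoin.
have [mq|/(unit_of_notin_max noeth loc)[p pq]] := pselect (m q).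
  by move: (idealD iJ zt (mt _ mq)); rewrite subrK.
case: nt; exists (p * r).
have -> : t - p * r * s = p * (z - r * s) - p * (z - q * t) + (1 - p * q) * t.
  by ring.
rewrite pq subrr mul0r addr0.
by apply: idealB => //; exact: idealMl.
Qed.

Lemma regular_exp x k r :
  (forall r, r * x = 0 -> r = 0) -> r * x ^+ k = 0 -> r = 0.
Proof.
move=> x_reg; elim: k r => [|k IH] r; first by rewrite mulr1.
by rewrite exprS mulrA => /IH /x_reg.
Qed.

Lemma principal_cancel x k a b : (forall r, r * x = 0 -> r = 0) ->
  principal (a * x ^+ k) (b * x ^+ k) -> principal a b.
Proof.
move=> x_reg; rewrite !principalE => -[r E]; exists r.
apply/eqP; rewrite -subr_eq0; apply/eqP.
by apply: (regular_exp (k := k) x_reg); rewrite mulrBl E; ring.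
Qed.

(** Multiplication by x^k maps the socle of R/(x) onto that of R/(x^(k+1)). *)
Lemma socle_gen_exp x s k : (forall r, r * x = 0 -> r = 0) -> m x ->
  socle_gen (principal x) s -> socle_gen (principal (x ^+ k.+1)) (s * x ^+ k).
Proof.
move=> x_reg mx [Js ms gens]; have iX := principal_ideal (x ^+ k.+1).
have up b : principal x b -> principal (x ^+ k.+1) (b * x ^+ k).
  by rewrite !principalE => -[r ->]; exists r; rewrite exprS mulrA.
have down b : principal (x ^+ k.+1) (b * x ^+ k) -> principal x b.
  by rewrite exprS; exact: principal_cancel.
split=> [/down //|a ma|t mt]; first by rewrite mulrA; apply: up; exact: ms.
have [c xt] : exists c, x * t = c * x ^+ k.+1.
  by move: (mt x mx); rewrite principalE.
have tE : t = c * x ^+ k.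
  apply/eqP; rewrite -subr_eq0; apply/eqP/x_reg.
  by rewrite mulrBl -mulrA -exprSr -xt; ring.
have [r Jr] : exists r, principal x (c - r * s).
  by apply: gens => a ma; apply: down; rewrite -mulrA -tE; exact: mt.
by exists r; rewrite tE mulrA -mulrBl; exact: up.
Qed.

(** If R had a nonzero socle, generated by s say, then s would generate the
    socle of R/(x), because (x) meets Gamma trivially. But so does a multiple of
    any z in m^n outside (x); up to an element of (x) it is a multiple of s,
    which then lies in both m^n and Gamma, so that it vanishes. *)
Lemma socle_zero x n : krull_dim_eq R 1%N -> is_parameter m x ->
  ideal_exp m n.+1 x -> ideal_exp m n `&` Gamma m = [set 0] ->
  irreducible_ideal (principal x) ->
  forall s, (forall a, m a -> a * s = 0) -> s = 0.
Proof.
move=> dim1 px mnx mnG irr s ms; apply: contrapT => s0.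
have iX := principal_ideal x; have [mx [i mi]] := px.
have imn := ideal_exp_ideal m n.
have mnx' : ideal_exp m n x := ideal_expS_sub mnx.
have Gs q : ideal_exp m n (q * s) -> q * s = 0.
  move=> mq; suff : [set 0] (q * s) by [].
  rewrite -mnG; split=> //; exists 1%N => a; rewrite (ideal_exp1 (max_ideal loc)).
  by move=> ma; rewrite mulrCA ms // mulr0.
have xs : ~ principal x s.
  move=> xs; apply: s0; rewrite -[s]mul1r; apply: Gs; rewrite mul1r.
  exact: (principal_sub imn mnx').
have x1 : ~ principal x 1.
  move=> x1; apply: (max_not1 loc).
  by apply: (principal_sub (max_ideal loc) mx).
have [s1 gen1] := irreducible_socle iX x1 mi irr.
have [_ _ gens] : socle_gen (principal x) s.
  by apply: (socle_gen_change iX gen1) => // a /ms ->; exact: ideal0.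
have [z mz xz] : exists2 z, ideal_exp m n z & ~ principal x z.
  apply: contrapT => /forall2NP H; apply: (parameter_neq0 noeth loc dim1 px).
  have : ideal_exp m n.+1 `<=` [set z | exists2 a, m a & z = a * x].
    apply: ideal_mul_min => [|a b ma mb].
      have im := max_ideal loc.
      split=> [|_ _ [a ma ->] [b mb ->]|b _ [a ma ->]].
      - by exists 0; [exact: ideal0|rewrite mul0r].
      - by exists (a + b); [exact: idealD|rewrite mulrDl].
      - by exists (b * a); [exact: idealMl|rewrite mulrA].
    have [//|/contrapT] := H b; rewrite principalE => -[c ->].
    by exists (a * c); [exact: (idealMr _ (max_ideal loc))|rewrite mulrA].
  move=> /(_ _ mnx)[a ma xE].
  have [b b1] := unit_1sub noeth loc ma.
  by rewrite -[x]mul1r -b1 -mulrA mulrBl mul1r -xE subrr mulr0.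
have [|r [xr mr]] := @socle_element R m (principal x) z i iX xz.
  by move=> a /mi xa; exact: (idealMr _ iX).
have [q xq] := gens _ mr; apply: xr.
suff qs0 : q * s = 0 by move: xq; rewrite qs0 subr0.
apply: Gs; have -> : q * s = r * z - (r * z - q * s) by ring.
apply: (idealB imn); first exact: (idealMl _ imn).
exact: (principal_sub imn mnx').
Qed.

(** Chains from C to D whose n successive quotients are zero or simple. *)
Fixpoint lchain n C D : Prop :=
  if n is n'.+1 then
    exists b, (forall a, m a -> C (a * b)) /\ lchain n' (adjoin C b) D
  else C = D.

(** Noetherian induction on C: a socle element of R/C inside D gives a step. *)
Lemma lchain_exists i C D : is_ideal C -> is_ideal D -> C `<=` D ->
  ideal_exp m i `<=` C -> exists n, lchain n C D.
Proof.
move=> iC iD; move: C iC; apply: (noeth_ind noeth) => C iC IH CD mC.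
have [DC|] := pselect (D `<=` C); first by exists 0%N; apply/seteqP.
move=> /existsNP[t /not_implyP[Dt Ct]].
have [|r [Cr mr]] := @socle_element R m C t i iC Ct.
  by move=> a /mC Ca; exact: idealMr.
have [||||n nC] := IH (adjoin C (r * t)).
- exact: adjoin_ideal.
- exact: proper_adjoin.
- by apply: adjoin_min => //; exact: idealMl.
- by apply: (subset_trans mC); exact: sub_adjoin.
- by exists n.+1, (r * t).
Qed.

Lemma lchain_rcons n C D b : lchain n C D -> (forall a, m a -> D (a * b)) ->
  lchain n.+1 C (adjoin D b).
Proof.
elim: n C => [C -> mb|n IH C [c [mc cD]] mb]; first by exists b.
by exists c; split=> //; exact: IH.
Qed.

(** Colon into J reverses chains as soon as the socle of R/J is simple: the
    elements of (J : C) send b into that socle. *)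
Lemma lchain_dual J s n C D : is_ideal J -> socle_gen J s -> is_ideal C ->
  lchain n C D -> lchain n (colonI J D) (colonI J C).
Proof.
move=> iJ gen; elim: n C => [C _ -> //|n IH C iC [b [mb cD]]].
have := IH _ (adjoin_ideal b iC) cD; rewrite colonI_adjoin // => chain.
have iJC := colonI_ideal C iJ.
have iL : is_ideal (colonI J C `&` colon J b).
  by apply: idealI => //; exact: colon_ideal.
have [Cb|] := pselect (colonI J C `<=` colon J b).
  have -> : colonI J C = adjoin (colonI J C `&` colon J b) 0.
    rewrite adjid //; first by rewrite setIidl.
    exact: ideal0.
  by apply: lchain_rcons => // a _; rewrite mulr0; exact: ideal0.
move=> /existsNP[t0 /not_implyP[Ct0 Jt0]].
have mJ t : colonI J C t -> forall a, m a -> J (a * (t * b)).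
  by move=> Ct a /mb /Ct; rewrite mulrCA.
have [_ _ gen0] := socle_gen_change iJ gen Jt0 (mJ _ Ct0).
have -> : colonI J C = adjoin (colonI J C `&` colon J b) t0.
  apply/seteqP; split=> [t Ct|]; last by apply: adjoin_min => // t [].
  have [r Jr] := gen0 _ (mJ _ Ct); exists r; split.
    by apply: (idealB iJC) => //; exact: (idealMl _ iJC).
  by rewrite /colon /= mulrBl -mulrA.
apply: lchain_rcons => // a ma; split; first exact: (idealMl _ iJC).
by rewrite /colon /= -mulrA; exact: mJ.
Qed.

(** Intersecting a chain from C to D with I either loses a step, or
    D is contained in C + I. *)
Lemma lchain_cap n C D I : is_ideal C -> is_ideal I -> lchain n C D ->
  exists2 n', lchain n' (C `&` I) (D `&` I) &
    (n' < n)%N \/ (n' = n /\ forall z, D z -> exists2 i, I i & C (z - i)).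
Proof.
move=> + iI; elim: n C => [C iC <-|n IH C iC [b [mb chain]]].
  exists 0%N => //; right; split=> // z Cz.
  by exists 0; [exact: ideal0|rewrite subr0].
have [n' chain' dicho] := IH _ (adjoin_ideal b iC) chain.
have [sub|] := pselect (adjoin C b `&` I `<=` C `&` I).
  exists n'; last by left; case: dicho => [/leqW|[-> _]].
  suff -> : C `&` I = adjoin C b `&` I by [].
  by apply/seteqP; split=> // z [Cz Iz]; split=> //; exact: sub_adjoin.
move=> /existsNP[t /not_implyP[[[r tr] It] Ct]].
have mr : ~ m r.
  move=> mr; apply: Ct; split=> //.
  by move: (idealD iC tr (mb _ mr)); rewrite subrK.
have [q qr] := unit_of_notin_max noeth loc mr.
have Cbt : C (b - q * t).
  have -> : b - q * t = (1 - q * r) * b - q * (t - r * b) by ring.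
  by rewrite qr subrr mul0r sub0r; apply: idealN => //; exact: idealMl.
have move_t z p : C (z - p * b) -> C (z - p * q * t).
  move=> Cz; have -> : z - p * q * t = (z - p * b) + p * (b - q * t) by ring.
  by apply: idealD => //; exact: idealMl.
exists n'.+1.
  exists t; split=> [a ma|].
    split; last exact: idealMl.
    have -> : a * t = a * (t - r * b) + r * (a * b) by ring.
    by apply: idealD => //; apply: idealMl => //; exact: mb.
  suff -> : adjoin (C `&` I) t = adjoin C b `&` I by [].
  apply/seteqP; split.
    apply: adjoin_min => [|z [Cz Iz]|]; [exact/idealI/iI/adjoin_ideal| |].
      by split=> //; exact: sub_adjoin.
    by split=> //; exists r.
  move=> z [[p zp] Iz]; exists (p * q); split; first exact: move_t.
  by apply: idealB => //; exact: idealMl.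
case: dicho => [lt|[-> dec]]; [by left|right; split=> // z /dec[i Ii [p zp]]].
exists (i + p * q * t); first by apply: idealD => //; exact: idealMl.
by rewrite opprD addrA; exact: move_t.
Qed.

(** Colon into J, applied twice, turns a shortest chain from J to I into a chain
    of the same length from J to (J : (J : I)); since the latter contains I, and
    the chain cannot lose a step on I, they are equal. *)
Lemma double_colon J s i I : is_ideal J -> ideal_exp m i `<=` J ->
  socle_gen J s -> is_ideal I -> J `<=` I -> colonI J (colonI J I) = I.
Proof.
move=> iJ mJ gen iI JI; apply/seteqP; split; last exact: sub_colonIK.
have exn : exists n, `[< lchain n J I >].
  by have [n ?] := lchain_exists iJ iI JI mJ; exists n; apply/asboolP.
have [n /asboolP chain nmin] := ex_minnP exn.
have JT : colonI J setT = J.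
  apply/seteqP; split=> [r /(_ 1)|r Jr a _]; first by rewrite mulr1; apply.
  exact: idealMr.
have JJ : colonI J J = setT.
  by apply/seteqP; split=> // r _ a Ja; exact: idealMl.
have chain1 := lchain_dual iJ gen iJ chain.
have := lchain_dual iJ gen (colonI_ideal I iJ) chain1.
rewrite JJ JT => /(lchain_cap iJ iI)[n' chain' dicho].
have chainI : lchain n' J I.
  move: chain'; rewrite (setIidl JI) setIidr //; exact: sub_colonIK.
case: dicho => [|[_ dec] z /dec[w Iw /JI Izw]].
  by rewrite ltnNge nmin //; exact/asboolP.
by rewrite -(subrK w z); exact: idealD.
Qed.

(** Self-injectivity of R/J. A map psi from I to R/J is extended one generator
    a at a time: if it is multiplication by r on K, the defect psi a - r a is
    killed by (K + J : a), hence lies in a (J : K + J) by double colons. *)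
Lemma self_injective J I (psi : R -> R) : is_ideal J ->
  (forall D, is_ideal D -> J `<=` D -> colonI J (colonI J D) = D) ->
  is_ideal I ->
  (forall a b, I a -> I b -> J (psi (a + b) - psi a - psi b)) ->
  (forall r a, I a -> J (psi (r * a) - r * psi a)) ->
  (forall a, I a -> J a -> J (psi a)) ->
  exists r, forall a, I a -> J (psi a - r * a).
Proof.
move=> iJ dcol iI psiD psiM psiJ.
pose P (K : set R) := exists r, forall a, K a -> J (psi a - r * a).
apply: (ideal_ind_up noeth (P := P) iI).
  by exists 0 => _ ->; rewrite mul0r subr0; apply: psiJ; exact: ideal0.
move=> K a iK KI Ia [r rK].
(* D is K + J and F is a (J : D) + J. *)
pose D : set R := [set z | exists2 k, K k & J (z - k)].
have iD : is_ideal D.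
  split=> [|y z [k Kk yk] [l' Kl zl]|b z [k Kk zk]].
  - by exists 0; [exact: ideal0|rewrite subr0; exact: ideal0].
  - by exists (k + l'); [exact: idealD|rewrite opprD addrACA; exact: idealD].
  - by exists (b * k); [exact: idealMl|rewrite -mulrBr; exact: idealMl].
have JD : J `<=` D by move=> z Jz; exists 0; [exact: ideal0|rewrite subr0].
have KD : K `<=` D by move=> z Kz; exists z => //; rewrite subrr; exact: ideal0.
have iJD := colonI_ideal D iJ.
pose F : set R := [set z | exists2 u, colonI J D u & J (z - u * a)].
have iF : is_ideal F.
  split=> [|y z [u Du yu] [v Dv zv]|b z [u Du zu]].
  - by exists 0; [exact: (ideal0 iJD)|rewrite mul0r subr0; exact: ideal0].
  - exists (u + v); first exact: (idealD iJD).
    by rewrite mulrDl opprD addrACA; exact: idealD.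
  - exists (b * u); first exact: (idealMl _ iJD).
    by rewrite -mulrA -mulrBr; exact: idealMl.
have JF : J `<=` F.
  by move=> z Jz; exists 0; [exact: (ideal0 iJD)|rewrite mul0r subr0].
have [u Du Ju] : F (psi a - r * a).
  rewrite -(dcol F) // => t Ft.
  have [k Kk Jk] : D (t * a).
    rewrite -(dcol D) // => u Du; rewrite -mulrA; apply: Ft.
    by exists u => //; rewrite mulrC subrr; exact: ideal0.
  have Ik := KI _ Kk.
  have Itk : I (t * a - k) by apply: idealB => //; exact: idealMl.
  have := psiD _ _ Ik Itk; rewrite [k + _]addrC subrK => JD1.
  have -> : (psi a - r * a) * t =
      (psi (t * a) - psi k - psi (t * a - k)) - (psi (t * a) - t * psi a)
      + psi (t * a - k) + (psi k - r * k) - r * (t * a - k) by ring.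
  apply: idealB => //; last exact: idealMl.
  apply: idealD => //; last exact: rK.
  apply: idealD => //; last exact: psiJ.
  by apply: idealB => //; exact: psiM.
exists (r + u) => z [p zp].
have Izp := KI _ zp; have Ipa : I (p * a) by exact: idealMl.
have := psiD _ _ Izp Ipa; rewrite subrK => JD1.
have -> : psi z - (r + u) * z =
   (psi z - psi (z - p * a) - psi (p * a)) + (psi (z - p * a) - r * (z - p * a))
   + (psi (p * a) - p * psi a) + p * (psi a - r * a - u * a) - u * (z - p * a).
  by ring.
apply: idealB => //; last exact/Du/KD.
apply: idealD => //; last exact: idealMl.
apply: idealD => //; last exact: psiM.
by apply: idealD => //; exact: rK.
Qed.

End Artinian.

(** * Baer's criterion and localisation at one element *)

Section Baer.
Variable R : comNzRingType.
Implicit Types (E : lmodType R) (I : set R).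

Definition linear_on E I (phi : R -> E) : Prop :=
  (forall a b, I a -> I b -> phi (a + b) = phi a + phi b) /\
  (forall r a, I a -> phi (r * a) = r *: phi a).

(** The condition of Baer's criterion, with maps from ideals to E represented by
    functions on R whose values outside the ideal do not matter. *)
Definition extends_ideals E : Prop := forall I (phi : R -> E),
  is_ideal I -> linear_on I phi -> exists e, forall a, I a -> phi a = a *: e.

(** Baer's criterion, by Zorn's lemma on the graphs of partial extensions. *)
Lemma baer E : extends_ideals E -> injective_module E.
Proof.
move=> extE A B f u injf.
pose graph (G : set (B * E)) :=
  [/\ is_submod G, forall y, G (0, y) -> y = 0 & forall a, G (f a, u a)].
pose G0 : set (B * E) := [set p | exists a, p = (f a, u a)].
have graph0 : graph G0.
  split=> [|y [a [fa ->]]|a]; last by exists a.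
    split=> [|_ _ [a ->] [b ->]|r _ [a ->]].
    - by exists 0; rewrite !linear0.
    - by exists (a + b); rewrite !linearD.
    - by exists (r *: a); rewrite !linZ.
  have -> : a = 0 by apply: injf; rewrite linear0.
  by rewrite linear0.
have [F FP Ftot|G [[GE|gG] Gmax]] := @Zorn_bigcup _ ([set set0] `|` graph).
- have [[G1 FG1 gG1]|noF] := pselect (exists2 G, F G & graph G); last first.
    left; apply/seteqP; split=> // p [G FG Gp].
    case: (FP _ FG) => [GE|gG]; first by rewrite GE in Gp.
    by case: noF; exists G.
  have gF G p : F G -> G p -> graph G.
    by move=> FG Gp; case: (FP _ FG) => // GE; rewrite GE in Gp.
  right; split=> [|y [G FG Gy]|a]; last 2 first.
  + by have [_ + _] := gF _ _ FG Gy; apply.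
  + by exists G1 => //; have [_ _] := gG1.
  split=> [|p q [G FG Gp] [H FH Hq]|r p [G FG Gp]].
  + by exists G1 => //; have [/submod0] := gG1.
  + have [iG _ _] := gF _ _ FG Gp; have [iH _ _] := gF _ _ FH Hq.
    case: (Ftot _ _ FG FH) => [GH|HG].
      by exists H => //; apply: (submodD iH) => //; exact: GH.
    by exists G => //; apply: (submodD iG) => //; exact: HG.
  + by have [iG _ _] := gF _ _ FG Gp; exists G => //; exact: (submodZ _ iG).
- exfalso; apply: (Gmax G0); last by right.
  rewrite GE; split; first exact: sub0set.
  by move=> /(_ (f 0, u 0)); apply; exists 0.
have [iG funG extG] := gG.
have uniG b y y' : G (b, y) -> G (b, y') -> y = y'.
  move=> Gy Gy'; apply/eqP; rewrite -subr_eq0; apply/eqP/funG.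
  by have := submodB iG Gy Gy'; rewrite -[(b, y) - _]/(b - b, y - y') subrr.
have total b : exists y, G (b, y).
  pose I : set R := [set r | exists y, G (r *: b, y)].
  have iI : is_ideal I.
    split=> [|r s [y Gy] [z Gz]|r s [y Gy]].
    - by exists 0; rewrite scale0r; exact: (submod0 iG).
    - by exists (y + z); rewrite scalerDl; exact: (submodD iG Gy Gz).
    - by exists (r *: y); rewrite -scalerA; exact: (submodZ r iG Gy).
  pose phi r : E := xget 0 [set y | G (r *: b, y)].
  have phiP r : I r -> G (r *: b, phi r).
    by move=> [y Gy]; exact: (@xgetI _ _ [set y | G (r *: b, y)] y).
  have [|e eP] := extE I phi iI.
    split=> [r s Ir Is|r s Is].
      apply: (uniG ((r + s) *: b)); first by apply: phiP; exact: idealD.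
      by rewrite scalerDl; exact: (submodD iG (phiP _ Ir) (phiP _ Is)).
    apply: (uniG ((r * s) *: b)); first by apply: phiP; exact: idealMl.
    by rewrite -scalerA; exact: (submodZ r iG (phiP _ Is)).
  (* The extension of the partial map by b |-> e. *)
  pose G' : set (B * E) := [set p | exists r, G (p.1 - r *: b, p.2 - r *: e)].
  have GG' : G `<=` G' by move=> -[c y] Gp; exists 0; rewrite !scale0r !subr0.
  have gG' : graph G'.
    split=> [|y [r /= Gr]|a]; last exact/GG'/extG.
      split=> [|[c y] [c' y'] [r /= Gr] [s /= Gs]|a [c y] [r /= Gr]].
      - by apply: GG'; exact: (submod0 iG).
      - exists (r + s) => /=; rewrite !scalerDl !opprD (addrACA c) (addrACA y).
        exact: (submodD iG Gr Gs).
      - exists (a * r) => /=; rewrite -!scalerA -!scalerBr.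
        exact: (submodZ a iG Gr).
    have Gr' : G (r *: b, r *: e - y).
      have := submodN iG Gr; rewrite -[- (_, _)]/(- _, - _).
      by rewrite sub0r opprK opprB.
    have Ir : I r by exists (r *: e - y).
    have := uniG _ _ _ Gr' (phiP _ Ir); rewrite (eP _ Ir) => /eqP.
    by rewrite subr_eq addrC -subr_eq subrr eq_sym => /eqP.
  have G'G : G' `<=` G.
    by apply: contrapT => nG; apply: (Gmax G'); [split|right].
  exists e; apply: G'G; exists 1; rewrite /= !scale1r !subrr.
  exact: (submod0 iG).
pose h b := projT1 (cid (total b)).
have hP b : G (b, h b) by rewrite /h; case: cid.
have hL : linear h.
  move=> r b c; apply: (uniG (r *: b + c)) => //.
  exact: (submodD iG (submodZ r iG (hP b)) (hP c)).
exists (mk_linear hL) => a /=; exact: (uniG (f a)).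
Qed.

End Baer.

Section Localization.
Variables (R : comNzRingType) (x : R).
Hypothesis x_reg : forall r, r * x = 0 -> r = 0.
Implicit Types (p : {poly R}) (d k : nat) (a r : R).

(** The value of x^d p(1/x), for p of degree at most d. *)
Let homog d (p : {poly R}) : R := \sum_(j < d.+1) p`_j * x ^+ (d - j).

Let homogD d p (q : {poly R}) : homog d (p + q) = homog d p + homog d q.
Proof.
by rewrite -big_split; apply: eq_bigr => j _; rewrite coefD mulrDl.
Qed.

Let homogZ d a p : homog d (a *: p) = a * homog d p.
Proof. by rewrite mulr_sumr; apply: eq_bigr => j _; rewrite coefZ mulrA. Qed.

Let homogS d p : (size p <= d.+1)%N -> homog d.+1 p = x * homog d p.
Proof.
move=> sp; rewrite /homog big_ord_recr /= nth_default // mul0r addr0 mulr_sumr.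
apply: eq_bigr => j _; have jd : (j <= d)%N by rewrite -ltnS.
by rewrite subSn // exprS mulrCA.
Qed.

Let homog_add d k p : (size p <= d.+1)%N -> homog (d + k) p = x ^+ k * homog d p.
Proof.
move=> sp; elim: k => [|k IH]; first by rewrite addn0 mul1r.
rewrite addnS homogS; last by apply: (leq_trans sp); rewrite ltnS leq_addr.
by rewrite IH exprS mulrA.
Qed.

Let homogX d p : homog d.+1 (p * 'X) = homog d p.
Proof.
rewrite /homog big_ord_recl coefMX /= mul0r add0r.
by apply: eq_bigr => j _; rewrite coefMX /= subSS.
Qed.

Let homogC d r : homog d (r *: 1) = r * x ^+ d.
Proof.
rewrite homogZ /homog big_ord_recl coef1 mul1r subn0 big1 ?addr0 // => j _.
by rewrite coef1 mul0r.
Qed.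

(** The module R[1/x], as the quotient of R[X] by the polynomials that vanish
    at 1/x; q1 is the class of 1. *)
Lemma localization : exists (Q : lmodType R) (q1 : Q),
  [/\ forall r, r *: q1 = 0 -> r = 0,
      forall q : Q, x *: q = 0 -> q = 0,
      forall q : Q, exists q', x *: q' = q
    & forall q : Q, exists n r, x ^+ n *: q = r *: q1].
Proof.
pose N : set {poly R} :=
  [set p | exists n, forall d, (n <= d)%N -> homog d p = 0].
have subN : is_submod N.
  split=> [|p q [k kp] [l lq]|a p [k kp]].
  - by exists 0%N => d _; rewrite -(scale0r 0) homogZ mul0r.
  - exists (maxn k l) => d; rewrite geq_max => /andP[kd ld].
    by rewrite homogD kp // lq // addr0.
  - by exists k => d kd; rewrite homogZ kp // mulr0.
have [Q [pi [surj ker]]] := quotient_module subN.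
exists Q, (pi 1); split=> [r|q|q|q].
- rewrite -linZ => /ker[n /(_ n (leqnn n))]; rewrite homogC.
  exact: regular_exp.
- have [p <-] := surj q; rewrite -linZ => /ker[n H].
  apply/ker; exists n => d nd; apply: x_reg.
  by rewrite mulrC -homogZ; exact: H.
- have [p <-] := surj q; exists (pi (p * 'X)).
  apply/eqP; rewrite -linZ -subr_eq0 -linearB; apply/eqP/ker.
  exists (size p).+1 => -[//|d] sd.
  rewrite -scaleN1r homogD !homogZ homogX homogS ?mulN1r ?subrr //.
  exact: ltnW.
- have [p <-] := surj q; exists (size p), (homog (size p) p).
  apply/eqP; rewrite -!linZ -subr_eq0 -linearB; apply/eqP/ker.
  exists (size p) => d sd; rewrite -scaleN1r homogD.
  rewrite homogZ [homog d (-1 *: _)]homogZ homogC.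
  by rewrite -(subnKC sd) homog_add // exprD; ring.
Qed.

End Localization.

(** * An injective resolution of length one *)

Section Resolution.
Variables (R : comNzRingType) (m : set R).
Hypotheses (noeth : is_noetherian R) (loc : is_local m).
Variables (x s : R).
Hypotheses (px : is_parameter m x) (x_reg : forall r, r * x = 0 -> r = 0).
Hypothesis gen : socle_gen m (principal x) s.
Variables (Q : lmodType R) (q1 : Q).
Hypothesis q1_reg : forall r, r *: q1 = 0 -> r = 0.
Hypothesis x_inj : forall q : Q, x *: q = 0 -> q = 0.
Hypothesis x_div : forall q : Q, exists q', x *: q' = q.
Hypothesis x_tors : forall q : Q, exists n r, x ^+ n *: q = r *: q1.
Variables (W : lmodType R) (p : {linear Q -> W}).
Hypothesis p_surj : forall w, exists q, p q = w.
Hypothesis p_ker : forall q, p q = 0 <-> exists r, q = r *: q1.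

Lemma q1_inj r t : r *: q1 = t *: q1 -> r = t.
Proof.
move=> E; apply/eqP; rewrite -subr_eq0; apply/eqP/q1_reg.
by rewrite scalerBl E subrr.
Qed.

Lemma xexp_inj n (q : Q) : x ^+ n *: q = 0 -> q = 0.
Proof.
elim: n q => [|n IH] q; first by rewrite scale1r.
by rewrite exprS -scalerA => /x_inj /IH.
Qed.

Lemma xexp_div n (q : Q) : exists q', x ^+ n *: q' = q.
Proof.
elim: n q => [|n IH] q; first by exists q; rewrite scale1r.
have [q' <-] := IH q; have [q'' <-] := x_div q'.
by exists q''; rewrite exprSr scalerA.
Qed.

Lemma x_tors_W (w : W) : exists n, x ^+ n *: w = 0.
Proof.
have [q <-] := p_surj w; have [n [r E]] := x_tors q.
by exists n; rewrite -linZ; apply/p_ker; exists r.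
Qed.

(** The exponent k.+1 reflects that R/(x^0) = 0 has no socle. *)
Lemma self_injective_exp k I (psi : R -> R) :
  let J := principal (x ^+ k.+1) in is_ideal I ->
  (forall a b, I a -> I b -> J (psi (a + b) - psi a - psi b)) ->
  (forall r a, I a -> J (psi (r * a) - r * psi a)) ->
  (forall a, I a -> J a -> J (psi a)) ->
  exists r, forall a, I a -> J (psi a - r * a).
Proof.
move=> J; have [mx [i mi]] := px.
apply: (self_injective noeth (principal_ideal _)) => D iD JD.
have genJ := socle_gen_exp k x_reg mx gen.
have mJ := principal_expX (j := k.+1) mi.
exact: (double_colon noeth loc (principal_ideal _) mJ genJ iD JD).
Qed.

(** A map from I to R[1/x]/R has image in x^-N R / R = R/(x^N), and it kills
    the intersection of I with (x^(M+N)) as soon as (I : x^M) is stable. Up to the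
    inclusion of R/(x^N) in R/(x^(M+N)) given by x^M, it is thus a map on an ideal
    of the self-injective ring R/(x^(M+N)). *)
Lemma quotient_extends : extends_ideals W.
Proof.
move=> I phi iI [phiD phiM].
have phi0 : phi 0 = 0 by rewrite -(mul0r 0) phiM ?scale0r //; exact: ideal0.
have [n nI] : exists n, forall a, I a -> x ^+ n *: phi a = 0.
  apply: (ideal_ind_up noeth
    (P := fun K => exists n, forall a, K a -> x ^+ n *: phi a = 0) iI).
    by exists 0%N => _ ->; rewrite phi0 scaler0.
  move=> K a iK KI Ia [n nK]; have [k ka] := x_tors_W (phi a).
  exists (k + n)%N => z [r Kz]; rewrite -(subrK (r * a) z).
  rewrite phiD ?phiM //; [|exact: KI|exact: idealMl].
  rewrite scalerDr exprD -scalerA nK // scaler0 add0r scalerA.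
  by rewrite -mulrA mulrC -scalerA ka scaler0.
have [M stab] := colon_stable noeth x iI.
(* x^(n+1) kills phi, and (x^(k+1)) with k = M + n is where phi extends. *)
pose k := (M + n)%N; pose J := principal (x ^+ k.+1).
pose rel a r := exists2 q, p q = phi a & x ^+ n.+1 *: q = r *: q1.
have relE a r t : rel a r -> rel a t -> J (x ^+ M * (r - t)).
  move=> [q pq qr] [q' pq' qt]; have [c cE] : exists c, q - q' = c *: q1.
    by apply/p_ker; rewrite linearB pq pq' subrr.
  rewrite /J principalE; exists c; rewrite (_ : r - t = x ^+ n.+1 * c).
    by rewrite /k -addnS exprD; ring.
  by apply: q1_inj; rewrite scalerBl -qr -qt -scalerBr cE scalerA.
have relD a b r t : I a -> I b -> rel a r -> rel b t -> rel (a + b) (r + t).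
  move=> Ia Ib [q pq qr] [q' pq' qt]; exists (q + q').
    by rewrite linearD pq pq' phiD.
  by rewrite scalerDr qr qt scalerDl.
have relM b a r : I a -> rel a r -> rel (b * a) (b * r).
  move=> Ia [q pq qr]; exists (b *: q); first by rewrite linZ pq phiM.
  by rewrite scalerA mulrC -scalerA qr scalerA.
pose rho a : R := xget 0 [set r | rel a r].
have rhoP a : I a -> rel a (rho a).
  move=> Ia; have [q pq] := p_surj (phi a).
  have [r qr] : exists r, x ^+ n.+1 *: q = r *: q1.
    by apply/p_ker; rewrite linZ pq exprS -scalerA nI // scaler0.
  by apply: (@xgetI _ _ [set r | rel a r] r); exists q.
have [|||r rP] := @self_injective_exp k I (fun a => x ^+ M * rho a) iI.
- move=> a b Ia Ib.
  have -> : x ^+ M * rho (a + b) - x ^+ M * rho a - x ^+ M * rho b = x ^+ M * (rho (a + b) - (rho a + rho b)) by ring.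
  by apply: relE; [apply: rhoP; exact: idealD|apply: relD => //; exact: rhoP].
- move=> b a Ia; have -> : x ^+ M * rho (b * a) - b * (x ^+ M * rho a)
    = x ^+ M * (rho (b * a) - b * rho a) by ring.
  by apply: relE; [apply: rhoP; exact: idealMl|apply: relM => //; exact: rhoP].
- move=> a Ia; rewrite principalE => -[b aE].
  have Ib : I (b * x ^+ M).
    have : colon I (x ^+ (M + n.+1)) b by rewrite /colon /= addnS -aE.
    by rewrite stab.
  rewrite -principalE -[rho a]subr0; apply: relE; first exact: rhoP.
  exists 0; last by rewrite scaler0 scale0r.
  have -> : a = x ^+ n.+1 * (b * x ^+ M) by rewrite aE /k -addnS exprD; ring.
  by rewrite linear0 phiM // exprS -scalerA nI // scaler0.
have [q0 q0E] := xexp_div k.+1 (r *: q1).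
exists (p q0) => a Ia; have [q pq qr] := rhoP a Ia.
apply/eqP; rewrite -pq -linZ -subr_eq0 -linearB; apply/eqP/p_ker.
have := rP a Ia; rewrite principalE => -[c cE]; exists c.
apply/eqP; rewrite -subr_eq0; apply/eqP/(@xexp_inj k.+1).
have -> : x ^+ k.+1 *: (q - a *: q0 - c *: q1)
    = (x ^+ M * rho a - r * a - c * x ^+ k.+1) *: q1.
  have -> : x ^+ k.+1 *: (q - a *: q0 - c *: q1) =
      x ^+ k.+1 *: q - a *: (x ^+ k.+1 *: q0) - (c * x ^+ k.+1) *: q1.
    by rewrite !scalerBr !scalerA (mulrC a) (mulrC c).
  have -> : x ^+ k.+1 *: q = (x ^+ M * rho a) *: q1.
    by rewrite -scalerA -qr scalerA -exprD /k addnS.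
  by rewrite q0E scalerA (mulrC a) !scalerBl.
by rewrite cE subrr scale0r.
Qed.

(** Subtracting the multiplication given by the extension to R[1/x]/R leaves
    a map from I to R. Applying this to psi/x for any psi from I to R shows that
    Hom(I, R) is generated modulo x by multiplications, so Nakayama's lemma shows
    that all its elements are multiplications by elements of R[1/x]. *)
Lemma localization_extends : extends_ideals Q.
Proof.
move=> I phi iI phiL.
(* chi is the remainder of f after subtraction of a multiplication. *)
have reduce (f : R -> Q) : linear_on I f ->
    exists (q : Q) (chi : R -> R^o),
      linear_on I chi /\ forall a, I a -> f a = a *: q + chi a *: q1.
  move=> [fD fM].
  have [|w wE] := quotient_extends (phi := p \o f) iI.
    split=> [a b Ia Ib|r a Ia] /=; first by rewrite fD // linearD.
    by rewrite fM // linZ.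
  have [q qw] := p_surj w; subst w.
  pose chi a : R := xget 0 [set r | f a - a *: q = r *: q1].
  have chiP a : I a -> f a - a *: q = chi a *: q1.
    move=> Ia; have [r rE] : exists r, f a - a *: q = r *: q1.
      by apply/p_ker; rewrite linearB linZ -wE // subrr.
    exact: (@xgetI _ _ [set r | f a - a *: q = r *: q1] r).
  exists q, chi; split; last first.
    by move=> a Ia; rewrite -chiP // addrC subrK.
  split=> [a b Ia Ib|r a Ia]; apply: q1_inj.
    rewrite scalerDl -!chiP //; last exact: idealD.
    by rewrite fD // scalerDl opprD addrACA.
  rewrite -scalerA -!chiP //; last exact: idealMl.
  by rewrite fM // scalerBr scalerA.
pose S : set (R -> R^o) := [set psi | linear_on I psi].
pose B : set (R -> R^o) :=
  [set psi | exists q, forall a, I a -> psi a *: q1 = a *: q].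
have iS : is_submod S.
  split=> [|f g [fD fM] [gD gM]|b f [fD fM]].
  - by split=> [a b _ _|r a _]; rewrite ?addr0 ?scaler0.
  - split=> [a b Ia Ib|r a Ia].
      by rewrite -[LHS]/(f _ + g _) fD // gD // addrACA.
    by rewrite -[LHS]/(f _ + g _) fM // gM // -scalerDr.
  - split=> [a c Ia Ic|r a Ia].
      by rewrite -[LHS]/(b *: f _) fD // scalerDr.
    by rewrite -[LHS]/(b *: f _) fM // !scalerA mulrC.
have iB : is_submod B.
  split=> [|f g [q qf] [t tg]|b f [q qf]].
  - by exists 0 => a _; rewrite scaler0 scale0r.
  - exists (q + t) => a Ia; rewrite scalerDr -qf // -tg //.
    by rewrite -scalerDl.
  - exists (b *: q) => a Ia.
    by rewrite -[(b *: f) a]/(b * f a) -scalerA qf // !scalerA mulrC.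
have fgS : fgmod B S.
  pose van (K : set R) : set (R -> R^o) := [set psi | forall a, K a -> psi a = 0].
  suff : fgmod B (S `&` van [set 0]).
    congr fgmod; apply/seteqP; split=> [f [] //|f Sf]; split=> // _ ->.
    by case: Sf => _ /(_ 0 0 (ideal0 iI)); rewrite mul0r scale0r.
  apply: (ideal_ind_down noeth (I := I)
    (P := fun K => fgmod B (S `&` van K))) => // [|K a iK KI Ia IHK||]; last 2 first.
  - exact: ideal_set0.
  - by move=> _ ->; exact: ideal0.
  - exists [::]; split=> // f [_ If]; exists 0 => a Ia.
    by rewrite If // scale0r scaler0.
  have evL : linear (fun f : R -> R^o => f a) by [].
  have iSK : is_submod (S `&` van K).
    split=> [|f g [Sf Kf] [Sg Kg]|b f [Sf Kf]].
    - by split=> //; exact: (submod0 iS).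
    - split; first exact: (submodD iS).
      by move=> c Kc; rewrite -[LHS]/(f c + g c) Kf // Kg // addr0.
    - split; first exact: (submodZ _ iS).
      by move=> c Kc; rewrite -[LHS]/(b *: f c) Kf // scaler0.
  apply: (fgmod_ext (g := mk_linear evL) (C := [set 0])) => //.
    apply: fgmod_ideal => //.
    split=> [|_ _ [f Sf <-] [g Sg <-]|b _ [f Sf <-]].
    - by exists 0 => //; exact: (submod0 iSK).
    - by exists (f + g) => //; exact: (submodD iSK).
    - by exists (b *: f) => //; exact: (submodZ _ iSK).
  suff -> : S `&` van K `&` mk_linear evL @^-1` [set 0] =
      S `&` van (adjoin K a) by [].
  apply/seteqP; split=> [f [[Sf Kf] fa]|f [Sf Kaf]].
    split=> // z [r Kz]; rewrite -(subrK (r * a) z); case: Sf => fD fM.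
    rewrite fD; [|exact: KI|exact: idealMl].
    by rewrite Kf // fM // [f a]fa scaler0 addr0.
  split; last exact/Kaf/adjoin_mem.
  by split=> // z Kz; apply: Kaf; exact: sub_adjoin.
have SB : S `<=` B.
  apply: (nakayama noeth loc px.1 iB fgS) => f [fD fM].
  pose fx a : Q := xget 0 [set q | x *: q = f a *: q1].
  have fxP a : x *: fx a = f a *: q1.
    have [q qE] := x_div (f a *: q1).
    exact: (@xgetI _ _ [set q | x *: q = f a *: q1] q).
  have x_cancel (q t : Q) : x *: q = x *: t -> q = t.
    move=> E; apply/eqP; rewrite -subr_eq0; apply/eqP/x_inj.
    by rewrite scalerBr E subrr.
  have [|q [chi [chiL chiP]]] := reduce fx.
    split=> [a b Ia Ib|r a Ia]; apply: x_cancel.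
      by rewrite scalerDr !fxP fD // scalerDl.
    by rewrite fxP fM // scalerA mulrC -[RHS]scalerA fxP scalerA.
  exists chi => //; exists (x *: q) => a Ia.
  rewrite -[(f - _) a]/(f a - x *: chi a) scalerBl -fxP chiP // scalerDr.
  by rewrite -[x *: chi a]/(x * chi a) -scalerA addrK !scalerA mulrC.
have [q [chi [chiL chiP]]] := reduce phi phiL.
have [t tE] := SB _ chiL.
by exists (q + t) => a Ia; rewrite chiP // tE // scalerDr.
Qed.

Lemma gorenstein_of_localization : gorenstein R.
Proof.
have [Z [pZ [surjZ kerZ]]] :=
  @quotient_module R R^o setT (And3 I (fun _ _ _ _ => I) (fun _ _ _ => I)).
have Z0 (z : Z) : z = 0 by have [v <-] := surjZ z; apply/kerZ.
have zeroL (V U : lmodType R) : linear (fun _ : V => 0 : U).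
  by move=> a u v; rewrite scaler0 addr0.
pose M i : lmodType R := if i is i'.+1 then if i' is 0%N then W else Z else Q.
have [e eE] := scale_linear q1.
pose d i : {linear M i -> M i.+1} :=
  match i return {linear M i -> M i.+1} with
  | 0%N => p
  | i'.+1 => mk_linear (@zeroL _ _)
  end.
exists 1%N, M, e, d; split.
- case=> [|[|i]]; apply: baer.
  + exact: localization_extends.
  + exact: quotient_extends.
  + by move=> I phi _ _; exists 0 => a _; rewrite scaler0; exact: Z0.
- by case=> [|[|i]] // _ u; exact: Z0.
- by move=> a b; rewrite !eE => /q1_inj.
- apply/seteqP; split=> [_ [r _ <-]|q /p_ker[r ->]].
    by apply/p_ker; exists r; rewrite eE.
  by exists r => //; rewrite eE.
- case=> [|i]; apply/seteqP; split=> // w.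
  + by move=> _; have [q <-] := p_surj w; exists q.
  + by move=> _; exists 0 => //=; rewrite [RHS]Z0.
Qed.

End Resolution.

Theorem gorenstein_of_irreducible (R : comNzRingType) (m : set R) x :
  is_noetherian R -> is_local m -> krull_dim_eq R 1%N -> is_parameter m x ->
  ideal_exp m (g_inv m).+1 x -> irreducible_ideal (principal x) -> gorenstein R.
Proof.
move=> noeth loc dim1 px mx irr.
have x_reg r : r * x = 0 -> r = 0.
  apply: (parameter_regular px).
  exact: (socle_zero noeth loc dim1 px mx (g_inv_spec noeth px) irr).
have [_ [i mi]] := px.
have x1 : ~ principal x 1.
  move=> x1; apply: (max_not1 loc).
  by apply: (principal_sub (max_ideal loc) px.1).
have [s gen] := irreducible_socle noeth loc (principal_ideal x) x1 mi irr.
have [Q [q1 [q1_reg x_inj x_div x_tors]]] := localization x_reg.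
have subq1 : is_submod [set q : Q | exists r, q = r *: q1].
  split=> [|_ _ [r ->] [t ->]|a _ [r ->]].
  - by exists 0; rewrite scale0r.
  - by exists (r + t); rewrite scalerDl.
  - by exists (a * r); rewrite scalerA.
have [W [p [p_surj p_ker]]] := quotient_module subq1.
exact: (gorenstein_of_localization noeth loc px x_reg gen q1_reg x_inj x_div
  x_tors p_surj p_ker).
Qed.

Theorem corollary2p7 (R : comNzRingType) (m : set R)
    (k : fieldType) (res : {rmorphism R -> k})
    (R_local : is_local m)
    (R_noeth : is_noetherian R)
    (res_surj : range res = [set: k])
    (res_ker : res @^-1` [set 0] = m)
    (k_inf : infinite_set [set: k])
    (R_dim1 : krull_dim_eq R 1%N) :
  let n := (maxn (c_inv m) (g_inv m)).+1 in
  gorenstein R <->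
  exists q : set R,
    [/\ is_parameter_ideal m q, q `<=` ideal_exp m n & irreducible_ideal q].
Proof.
move=> n; split=> [[N [M [e [d [injM M0 inj_e ex0 exS]]]]]|].
  have [x px] := exists_parameter R_noeth R_local R_dim1.
  have pxn := parameter_exp R_local px (ltn0Sn (maxn (c_inv m) (g_inv m))).
  exists (principal (x ^+ n)); split.
  - by exists (x ^+ n).
  - apply: principal_sub; first exact: ideal_exp_ideal.
    by apply: ideal_expX; case: px.
  - exact: (parameter_irreducible R_noeth R_local injM inj_e ex0 exS M0 R_dim1
      pxn).
move=> [_ [[x px ->] xn irr]].
apply: (gorenstein_of_irreducible R_noeth R_local R_dim1 px _ irr).
apply: (ideal_exp_le (i := (g_inv m).+1) (j := n)).
  by rewrite ltnS leq_maxr.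
by apply: xn; exact: principal_mem.
Qed.
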